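(* Let $X$ be a reflexive Banach space and let $Z$ be a Hausdorff, locally convex topological vector space. Let $C\subseteq Z$ be a convex, pointed cone with nonempty interior, and let $K$ be a nonempty, convex and closed subset of $X$. Let $D\subseteq K$ be a self segment-dense set in $K$ in the weak topology of $X$, and consider a mapping $f:K\times K\to Z$ satisfying (i) for all $y\in D$, the mapping $x\mapsto f(x,y)$ is $C$-upper semicontinuous on $K$ in the weak topology of $X$; (ii) for all $x\in K$, the mapping $y\mapsto f(x,y)$ is $C$-upper semicontinuous on $K\setminus D$ in the weak topology of $X$; (iii) for all $x\in K$, the mapping $y\mapsto f(x,y)$ is $C$-convex on $K$; (iv) for all $x\in K$, $f(x,x)=0$; (v) there exists $r>0$ such that for all $x\in K$ with $\|x\|>r$ there exists $y_0\in K$ with $\|y_0\|<\|x\|$ such that $f(x,y_0)\in -\operatorname{int} C\cup\{0\}$. Then there exists $x_0\in K$ such that $f(x_0,y)\notin -\operatorname{int} C$ for all $y\in K$.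
   Context: All vector spaces are real. $\operatorname{int}$ denotes interior and $\operatorname{cl}$ closure. $-\operatorname{int}C\cup\{0\}$ means $(-\operatorname{int}C)\cup\{0\}$. A set $C\subseteq Z$ is a cone if $tc\in C$ for all $c\in C$ and $t\ge 0$; it is convex if $C+C=C$, and pointed if $C\cap(-C)=\{0\}$. Write $z_1\le z_2$ iff $z_2-z_1\in C$. $C$-upper semicontinuity: a map $g:K\to Z$ is $C$-upper semicontinuous at $x\in K$ if for any neighborhood $V$ of $g(x)$ there exists a neighborhood $U$ of $x$ such that $g(u)\in V-C$ for all $u\in U\cap K$. It is $C$-upper semicontinuous on a subset $S\subseteq K$ if it is so, as a map on $K$, at every point of $S$. ''In the weak topology of $X$'' means that the neighborhoods $U$ are taken in the weak topology of $X$. $C$-convexity: for a set $S$, $g$ is $C$-convex on $S$ if for all $n\in\mathbb N$, $x_1,\dots,x_n\in S$ and $\lambda_1,\dots,\lambda_n\ge 0$ with $\sum_{i=1}^n\lambda_i=1$ such that $\sum_{i=1}^n\lambda_i x_i\in S$, one has $g\left(\sum_{i=1}^n\lambda_i x_i\right)\le\sum_{i=1}^n\lambda_i g(x_i)$. Self segment-dense set: let $U\subseteq V\subseteq X$ with $V$ convex. $U$ is self segment-dense in $V$ if $U$ is dense in $V$ (i.e. $V\subseteq\operatorname{cl}U$) and for all $x,y\in U$ the set $[x,y]\cap U$ is dense in $[x,y]$, where $[x,y]=\{x+t(y-x):t\in[0,1]\}$. ''In the weak topology'' means that closures are taken in the weak topology of $X$.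
   Formalization: The formal theorem additionally assumes Z ≠ {0}; for Z = {0} and C = {0} one has int C = {0}, so f = 0 satisfies all hypotheses while the conclusion fails. *)

(* Defs.v *)
From HB Require Import structures.
From mathcomp Require Import all_boot all_order all_algebra.
From mathcomp Require Import all_classical all_reals all_analysis.

Set Implicit Arguments.
Unset Strict Implicit.
Unset Printing Implicit Defensive.

Import Order.TTheory GRing.Theory Num.Theory.
Import numFieldNormedType.Exports.

Local Open Scope classical_set_scope.
Local Open Scope ring_scope.

Section Dual.
Context {R : realType} (X : normedModType R).

Definition continuous_linear_form : {pred X -> R^o} :=
  fun phi => `[< linear phi /\ continuous phi >].

Lemma continuous_linear_form_submod : submod_closed continuous_linear_form.
Proof.
split; first by apply/asboolP; split=> [a u v|x];
  [rewrite /= scaler0 addr0|exact: cvg_cst].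
move=> a f g /asboolP[lf cf] /asboolP[lg cg]; apply/asboolP; split.
  move=> b u v; rewrite -[LHS]/(a *: f (b *: u + v) + g (b *: u + v)).
  rewrite lf lg -[RHS]/(b *: (a *: f u + g u) + (a *: f v + g v)).
  by rewrite !scalerDr !scalerA [b * a]mulrC addrACA.
by move=> x; apply: cvgD; [apply: cvgZr; exact: cf|exact: cg].
Qed.

HB.instance Definition _ := GRing.isSubmodClosed.Build R (X -> R^o)
  continuous_linear_form continuous_linear_form_submod.

Definition dual : Type := {phi : X -> R^o | phi \in continuous_linear_form}.

HB.instance Definition _ := SubChoice.copy dual
  {phi : X -> R^o | phi \in continuous_linear_form}.
HB.instance Definition _ := [SubChoice_isSubLmodule of dual by <:].

Definition dual_fun (phi : dual) : X -> R^o := val phi.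
Coercion dual_fun : dual >-> Funclass.

Definition dual_norm (phi : dual) : R :=
  sup [set `|phi x| | x in [set x : X | `|x| <= 1]].

Lemma dual_linear (phi : dual) : linear phi.
Proof. by have /asboolP[] := valP phi. Qed.

Lemma dual_continuous (phi : dual) : continuous phi.
Proof. by have /asboolP[] := valP phi. Qed.

Lemma dual0 (phi : dual) : phi 0 = 0.
Proof.
by have := dual_linear phi (-1) 0 0; rewrite scaler0 addr0 scaleN1r addNr.
Qed.

Lemma dualZ (phi : dual) a x : phi (a *: x) = a *: phi x.
Proof. by have := dual_linear phi a x 0; rewrite dual0 !addr0. Qed.

Lemma dual_norm_has_sup (phi : dual) :
  has_sup [set `|phi x| | x in [set x : X | `|x| <= 1]].
Proof.
split; first by exists `|phi 0|, 0 => //=; rewrite normr0.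
pose lphi := GRing.isLinear.Build R X R^o *:%R phi (dual_linear phi).
pose f : {linear X -> R^o} := HB.pack (phi : X -> R^o) lphi.
have /bounded_funP/(_ 1)[M HM] : bounded_near f (nbhs (0 : X)).
  by apply/linear_bounded_continuous; exact: dual_continuous.
by exists M => _ [x /= x1 <-]; exact: HM.
Qed.

Lemma ler_dual_norm (phi : dual) x : `|x| <= 1 -> `|phi x| <= dual_norm phi.
Proof.
move=> x1; apply: ub_le_sup; last by exists x.
by have [] := dual_norm_has_sup phi.
Qed.

Lemma dual_norm_le (phi : dual) M :
  (forall x, `|x| <= 1 -> `|phi x| <= M) -> dual_norm phi <= M.
Proof.
move=> phiM; apply: ge_sup; first by have [] := dual_norm_has_sup phi.
by move=> _ [x /= x1 <-]; exact: phiM.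
Qed.

Lemma dual_norm_ge0 (phi : dual) : 0 <= dual_norm phi.
Proof. by apply: (le_trans (normr_ge0 (phi 0))); rewrite ler_dual_norm// normr0. Qed.

Lemma dual_normD (phi psi : dual) :
  dual_norm (phi + psi) <= dual_norm phi + dual_norm psi.
Proof.
apply: dual_norm_le => x x1; rewrite -[dual_fun _ x]/(phi x + psi x).
by rewrite (le_trans (ler_normD _ _))// lerD// ler_dual_norm.
Qed.

Lemma dual_normZ a (phi : dual) : dual_norm (a *: phi) = `|a| * dual_norm phi.
Proof.
have leZ b (psi : dual) : dual_norm (b *: psi) <= `|b| * dual_norm psi.
  apply: dual_norm_le => x x1; rewrite -[dual_fun _ x]/(b * psi x).
  by rewrite normrM ler_wpM2l// ler_dual_norm.
apply/eqP; rewrite eq_le leZ/=; have [->|a0] := eqVneq a 0.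
  by rewrite normr0 mul0r dual_norm_ge0.
rewrite mulrC -ler_pdivlMr ?normr_gt0// mulrC -normfV.
by rewrite -{1}[phi]scale1r -(mulVf a0) -scalerA leZ.
Qed.

Lemma dual_norm0_eq0 (phi : dual) : dual_norm phi = 0 -> phi = 0.
Proof.
move=> phi0; apply/val_inj/funext => x; rewrite -[LHS]/(phi x).
have [->|x0] := eqVneq x 0; first by rewrite dual0.
have : `|phi (`|x|^-1 *: x)| <= 0.
  by rewrite -phi0 ler_dual_norm// normrZ normfV normr_id mulVf// normr_eq0.
rewrite normr_le0 dualZ scaler_eq0 invr_eq0 normr_eq0 (negbTE x0)/=.
by move/eqP.
Qed.

HB.instance Definition _ := Lmodule_isNormed.Build R dual
  dual_normD dual_normZ dual_norm0_eq0.

End Dual.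

(* Surjectivity of the canonical embedding of X into its bidual. *)
Definition reflexive_space {R : realType} (X : normedModType R) : Prop :=
  forall F : dual (dual X), exists x : X, forall phi : dual X, F phi = phi x.

(* X with its weak topology: the coarsest topology making every continuous
   linear form continuous. *)
Definition weak_space {R : realType} (X : normedModType R) : Type :=
  sup_topology
    (fun phi : dual X => Topological.on (initial_topology (phi : X -> R^o))).

HB.instance Definition _ (R : realType) (X : normedModType R) :=
  Topological.copy (weak_space X) (sup_topology
    (fun phi : dual X => Topological.on (initial_topology (phi : X -> R^o)))).
HB.instance Definition _ (R : realType) (X : normedModType R) :=
  GRing.Lmodule.copy (weak_space X) X.

Section Cones.
Context {R : realType} {Z : lmodType R}.
Implicit Type C : set Z.

Definition cone C := forall (t : R) c, 0 <= t -> C c -> C (t *: c).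

Definition convex_cone C :=
  cone C /\ [set c1 + c2 | c1 in C & c2 in C] = C.

Definition pointed_cone C := C `&` [set - c | c in C] = [set 0].

Definition cone_le C (z1 z2 : Z) := C (z2 - z1).

End Cones.

(* A map K -> Z is represented by a function on the whole space, of which only
   the values on K are used. *)
Definition upper_semicontinuous_at {R : realType} {T : topologicalType}
    {Z : tvsType R} (C : set Z) (K : set T) (g : T -> Z) (x : T) :=
  forall V, nbhs (g x) V -> exists2 U, nbhs x U &
    forall u, (U `&` K) u -> [set v - c | v in V & c in C] (g u).

Definition cone_convex_on {R : realType} {X Z : lmodType R} (C : set Z)
    (S : set X) (g : X -> Z) :=
  forall (n : nat) (x : 'I_n -> X) (lambda : 'I_n -> R),
    (forall i, S (x i)) -> (forall i, 0 <= lambda i) ->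
    \sum_(i < n) lambda i = 1 -> S (\sum_(i < n) lambda i *: x i) ->
    cone_le C (g (\sum_(i < n) lambda i *: x i))
              (\sum_(i < n) lambda i *: g (x i)).

Section SegmentDense.
Context {R : realType} {X : preTopologicalLmodType R}.

Definition segment (x y : X) : set X :=
  [set x + t *: (y - x) | t in [set t : R | 0 <= t <= 1]].

Definition self_segment_dense (U V : set X) :=
  [/\ U `<=` V, V `<=` closure U &
    forall x y, U x -> U y -> segment x y `<=` closure (segment x y `&` U)].

End SegmentDense.

(* Main.v *)
Require Import Defs.
From mathcomp Require Import all_boot all_order all_algebra.
From mathcomp Require Import all_classical all_reals all_analysis.
From mathcomp Require Import lra.

(** Any [x] solving the problem on the weakly compact set
[B = K /\ {|x| <= rho}], [rho > r], solves it on [K]: a strict improvement at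
[y] would, by convexity, give one at a point of [K] of norm [< rho] close to
[x] (if [|x| < rho]) or to the point given by coercivity (if [|x| = rho]).

On [B], only test points [y] in [D] of norm [< rho] are needed. The problem for
finitely many of them is a KKM-type intersection property on a simplex, and
weak compactness of [B] passes to all of them. The points of [K \ D] follow by
semicontinuity in [y] if [D] is dense there. Weak density of [D] in [K] is of no
use for this, as it does not localize to balls; but self segment-density makes
the norm closure of [D] convex, hence weakly closed by Hahn-Banach separation,
hence equal to [K], and norm density does localize.

The simplex lemma comes from a combinatorial lemma of Scarf rather than from
Sperner's lemma, so that no triangulation is involved: the points of a grid are
compared along each coordinate, and a parity argument produces a small cluster
of grid points carrying all the colours of a set outside of which the
coordinates almost vanish. *)

Set Implicit Arguments.
Unset Strict Implicit.
Unset Printing Implicit Defensive.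

Import Order.TTheory GRing.Theory Num.Theory.
Import numFieldNormedType.Exports.

(** * Scarf's lemma *)

Section Scarf.
Import ssrnat fintype mathcomp.boot.finset bigop.

Context {T I : finType}.
Variables (rk : I -> T -> nat) (c : T -> I).
Hypothesis rk_inj : forall i, injective (rk i).

Implicit Types (s : {set T}) (C : {set I}) (r d : {set T} * {set I}).

(* The pairs (points, indices) of Scarf's lemma; rooms and doors are the
   full-dimensional and the facet-like dominant pairs, and play the part of the
   simplices and facets of a triangulation in Sperner's lemma. *)
Definition dominant r :=
  [forall y, exists i in r.2, forall x in r.1, rk i y <= rk i x].

Definition room r := dominant r && (#|r.1| == #|r.2|).

Definition door d := dominant d && (#|d.2| == #|d.1|.+1).

Definition facet d r := (d.1 \subset r.1) && (r.2 \subset d.2).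

Lemma dominantP r : reflect
  (forall y, exists2 i, i \in r.2 & forall x, x \in r.1 -> rk i y <= rk i x)
  (dominant r).
Proof.
apply: (iffP forallP) => h y.
  by have /exists_inP[i ir /forall_inP] := h y; exists i.
by have [i ir hi] := h y; apply/exists_inP; exists i => //; exact/forall_inP.
Qed.

Lemma dominant_facet d r : facet d r -> dominant r -> dominant d.
Proof.
move=> /andP[/subsetP dr /subsetP rd] /dominantP domr.
apply/dominantP => y; have [i ir hi] := domr y.
by exists i; [exact: rd|move=> x /dr; exact: hi].
Qed.

(** The cardinals satisfy |d.1| <= |r.1| = |r.2| <= |d.2| = |d.1| + 1, so exactly one of the two
    inclusions in [facet d r] is strict, and by a single element. *)
Lemma facetP d r : #|d.2| = #|d.1|.+1 -> #|r.1| = #|r.2| -> facet d r ->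
  (exists2 i, i \in d.2 & r = (d.1, d.2 :\ i)) \/
  (exists2 y, y \notin d.1 & r = (y |: d.1, d.2)).
Proof.
case: d r => [t D] [s C] /= cD cs /andP[/= ts CD].
have := subset_leq_card ts; have := subset_leq_card CD.
rewrite cD -cs leq_eqVlt => /orP[/eqP e _|].
  right; have eC : C = D by apply/eqP; rewrite eqEcard CD -cs e cD leqnn.
  have /cards1P[y sty] : #|s :\: t| == 1.
    by rewrite cardsDS// e subSnn.
  have : y \in s :\: t by rewrite sty inE.
  rewrite inE => /andP[yt ys]; exists y => //; rewrite eC; congr pair.
  by rewrite -[LHS](setID s t) sty (setIidPr ts) setUC.
rewrite ltnS => le1 le2; left.
have es : s = t by apply/esym/eqP; rewrite eqEcard ts.
have /cards1P[y sty] : #|D :\: C| == 1 by rewrite cardsDS// cD -cs es subSnn.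
have : y \in D :\: C by rewrite sty inE.
rewrite inE => /andP[yt ys]; exists y => //; rewrite es; congr pair.
apply/setP => z; rewrite !inE; have := congr1 (fun A : {set I} => z \in A) sty.
rewrite !inE => <-; rewrite negb_and negbK; case: (boolP (z \in C)) => //=.
  by move/(subsetP CD) => ->.
by rewrite andNb.
Qed.

(** * Rooms adjacent to a door *)

Section Door.
Variables (t : {set T}) (D : {set I}) (x0 : T).
Hypotheses (x0t : x0 \in t) (domd : dominant (t, D)) (cardD : #|D| = #|t|.+1).

Let m i := [arg min_(x < x0 in t) rk i x].

Let m_in i : m i \in t.
Proof. by rewrite /m; case: arg_minnP. Qed.

Let m_le i x : x \in t -> rk i (m i) <= rk i x.
Proof. by rewrite /m; case: arg_minnP => // y _ h /h. Qed.

Let m_uniq i x : x \in t -> (forall z, z \in t -> rk i x <= rk i z) -> m i = x.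
Proof.
move=> xt h; apply: (rk_inj (i := i)); apply/eqP.
by rewrite eqn_leq m_le// h// m_in.
Qed.

(** Dominance tested at a point [x] of [t] itself gives an index at which [x] is minimal. *)
Let m_surj_of_dominant C : dominant (t, C) -> m @: C = t.
Proof.
move=> /dominantP dom; apply/setP => x; apply/imsetP/idP => [[i _ ->]//|xt].
by have [i iC hi] := dom x; exists i => //; apply/esym/m_uniq.
Qed.

Let bij i := (i \in D) && (m @: (D :\ i) == t).

Let bij_inj i : bij i -> {in D :\ i &, injective m}.
Proof.
case/andP=> iD /eqP e; apply/imset_injP.
by rewrite e; have := cardsD1 i D; rewrite iD cardD => -[->].
Qed.

Let collision : exists a b, [/\ a != b, a \in D, b \in D & m a = m b].
Proof.
apply/not_existsP => h.
suff /imset_injP : {in D &, injective m}.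
  rewrite (m_surj_of_dominant domd) cardD.
  by rewrite eqn_leq ltnn andbF.
move=> a b aD bD mab; apply/eqP/negPn/negP => ab.
by apply: (h a); exists b.
Qed.

(** [m] maps [D] onto [t], which has one element fewer, so exactly two indices share their minimal
    point; dropping either of them leaves a bijection. *)
Let bij_pair : exists a b, [/\ a != b, bij a, bij b &
  forall i, bij i -> i = a \/ i = b].
Proof.
have [a [b [ab aD bD mab]]] := collision.
have half a' b' : a' != b' -> a' \in D -> b' \in D -> m a' = m b' -> bij a'.
  move=> ab' aD' bD' mab'; rewrite /bij aD'/=; apply/eqP/setP => x.
  apply/imsetP/idP => [[i _ ->]//|]; rewrite -{1}(m_surj_of_dominant domd).
  move=> /imsetP[i iD ->]; have [->|ia] := eqVneq i a'.
    by exists b' => //; rewrite !inE eq_sym ab'.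
  by exists i => //; rewrite !inE ia.
exists a, b; split => //; first exact: (half a b).
  by apply: (half b a) => //; rewrite eq_sym.
move=> i bi; have [->|ia] := eqVneq i a; first by left.
have [->|ib] := eqVneq i b; first by right.
have aDi : a \in D :\ i by rewrite !inE eq_sym ia.
have bDi : b \in D :\ i by rewrite !inE eq_sym ib.
by move/eqP: ab; case; exact: (bij_inj bi).
Qed.

Let above i y := [forall j in D :\ i, rk j (m j) < rk j y].

(* The rooms behind a door lie on its two sides, one for each of the two indices
   that share their minimal point: a room on side [i] either drops [i] or adds a
   point that becomes minimal for [i]. *)
Let side i r := r = (t, D :\ i) \/
  exists y, [/\ y \notin t, r = (y |: t, D) & above i y].

(** A point exceeding the minima of [t] at all other indices of [D] can only be dominated at [i]. *)
Let above_rk i y : above i y -> rk i y <= rk i (m i).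
Proof.
move=> /forall_inP ay; have /dominantP/(_ y)[/= j jD hj] := domd.
have [<-|ji] := eqVneq j i; first exact: hj.
have : rk j (m j) < rk j y by apply: ay; rewrite !inE ji.
by rewrite ltnNge hj.
Qed.

(** [(t, D :\ i)] is dominant only if no point is above [i], and a point added to [t] must have the
    largest [rk i] among the points above [i]. *)
Let side_uniq i r r' : room r -> room r' -> side i r -> side i r' -> r = r'.
Proof.
have noabove y : dominant (t, D :\ i) -> ~~ above i y.
  move=> /dominantP/(_ y)[/= j jD hj]; apply/negP => /forall_inP/(_ j jD).
  by rewrite ltnNge hj.
have le y y' : dominant (y |: t, D) -> above i y' -> rk i y' <= rk i y.
  move=> /dominantP/(_ y')[/= j jD hj] /forall_inP ay'.
  have [<-|ji] := eqVneq j i; first by apply: hj; rewrite setU11.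
  have : rk j (m j) < rk j y' by apply: ay'; rewrite !inE ji.
  by rewrite ltnNge hj// setU1r.
move=> /andP[domr _] /andP[domr' _].
move=> [er|[y [yt er ay]]] [er'|[y' [yt' er' ay']]].
- by rewrite er.
- by rewrite er in domr; have := noabove y' domr; rewrite ay'.
- by rewrite er' in domr'; have := noabove y domr'; rewrite ay.
rewrite er er'; congr (_ |: _, _); apply: (rk_inj (i := i)); apply/eqP.
by rewrite eqn_leq !le// -?er -?er'.
Qed.

(** If no point is above [i], dropping [i] keeps dominance; otherwise a point above [i] with the
    largest [rk i] can be added. *)
Let side_exists i : bij i -> exists r, [/\ room r, facet (t, D) r & side i r].
Proof.
case/andP=> iD /eqP ei.
have cDi : #|D :\ i| = #|t|.
  by have := cardsD1 i D; rewrite iD cardD => -[->].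
have [y0 ay0|none] := pickP (above i); last first.
  exists (t, D :\ i); split; last by left.
    rewrite /room/= cDi eqxx andbT; apply/dominantP => y /=.
    have /negbT := none y; rewrite negb_forall_in => /exists_inP[j jD].
    rewrite -leqNgt => hj; exists j => // x xt; exact: leq_trans (m_le _ xt).
  by rewrite /facet/= subxx subsetDl.
have [y ay ymax] := @arg_maxnP _ _ (above i) (rk i) ay0.
have yt : y \notin t.
  rewrite -ei; apply/negP => /imsetP[j jD yj].
  by have /forall_inP/(_ j jD) := ay; rewrite yj ltnn.
exists (y |: t, D); split; last by right; exists y.
  rewrite /room/= cardsU1 yt cardD add1n eqxx andbT; apply/dominantP => z /=.
  have [az|] := boolP (above i z).
    exists i => // x; rewrite in_setU1 => /orP[/eqP->|xt]; first exact: ymax.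
    by rewrite (leq_trans (above_rk az))// m_le.
  rewrite negb_forall_in => /exists_inP[j jD]; rewrite -leqNgt => hj.
  exists j => [|x]; first by move: jD; rewrite inE => /andP[].
  rewrite in_setU1 => /orP[/eqP->|xt]; last exact: leq_trans (m_le _ xt).
  by have /forall_inP/(_ j jD)/ltnW := ay; exact: leq_trans.
by rewrite /facet/= subxx subsetU1.
Qed.

Let room_side r : room r -> facet (t, D) r -> exists2 i, bij i & side i r.
Proof.
move=> /andP[domr /eqP cr] fr.
have [[i iD er]|[y yt er]] := facetP (d := (t, D)) cardD cr fr.
  exists i; last by left.
  rewrite er in domr.
  by rewrite /bij iD/=; apply/eqP/m_surj_of_dominant.
have /dominantP/= dom : dominant (y |: t, D) by rewrite -er.
have [i iD hi] := dom y.
(* As [y] is minimal at [i], dominance tested at a point of [t] must be witnessed by another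
   index. *)
have pre x : x \in t -> exists2 j, j \in D :\ i & m j = x /\ rk j x <= rk j y.
  move=> xt; have [j jD hj] := dom x; exists j.
    rewrite !inE jD andbT; apply: contra yt => /eqP ji; rewrite -{1}ji in hi.
    have := hj y; have := hi x; rewrite ji setU11 setU1r// => /(_ isT) h1.
    move/(_ isT) => h2; rewrite -(_ : x = y)//; apply: (rk_inj (i := i)).
    by apply/eqP; rewrite eqn_leq h1 h2.
  split; last by apply: hj; rewrite setU11.
  by apply: m_uniq => // z zt; apply: hj; rewrite setU1r.
have bi : bij i.
  rewrite /bij iD/=; apply/eqP/setP => x; apply/imsetP/idP => [[j _ ->]//|].
  by move=> /pre[j jD [jx _]]; exists j.
exists i => //; right; exists y; split=> //.
apply/forall_inP => j jD; have [k kD [mk hk]] := pre _ (m_in j).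
have kj : k = j by apply: (bij_inj bi).
rewrite kj in hk.
rewrite ltn_neqAle hk andbT; apply: contra yt => /eqP/rk_inj <-; exact: m_in.
Qed.

Lemma door_two_rooms : #|[set r | room r & facet (t, D) r]| = 2.
Proof.
have [a [b [ab ba bb abi]]] := bij_pair.
have [ra [rra fra sa]] := side_exists ba.
have [rb [rrb frb sb]] := side_exists bb.
have rab : ra != rb.
  (* A room on both sides could only add a point above both [a] and [b]. It would exceed the minima
     of [t] at every index of [D], against dominance of the door. *)
  apply/eqP => e; rewrite -e in sb.
  have Dneq i : i \in D -> D :\ i != D.
    by move=> iD; apply/eqP => h; have := iD; rewrite -h !inE eqxx.
  have [aD _] := andP ba; have [bD _] := andP bb.
  case: sa sb => [->|[y [yt er ay]]] [|[y' [yt' er' ay']]].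
  - move=> -[] h; have := aD; rewrite -[a \in D]andTb -{1}ab -in_setD1 -h.
    by rewrite !inE eqxx.
  - by case: er' => _ /eqP; rewrite (negbTE (Dneq _ aD)).
  - by move=> h; move: er; rewrite h => -[_ /eqP]; rewrite (negbTE (Dneq _ bD)).
  have yy : y = y'.
    have : y \in y' |: t by move: er'; rewrite er => -[<-]; rewrite setU11.
    by rewrite in_setU1 (negbTE yt) orbF => /eqP.
  have /dominantP/(_ y)[/= j jD hj] := domd.
  have : rk j (m j) < rk j y.
    have [ja|ja] := eqVneq j a.
      by move/forall_inP: ay'; rewrite -yy; apply; rewrite !inE ja ab.
    by move/forall_inP: ay; apply; rewrite !inE ja.
  by rewrite ltnNge hj.
suff -> : [set r | room r & facet (t, D) r] = [set ra; rb].
  by rewrite cards2 rab.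
apply/setP => r; rewrite !inE; apply/andP/orP => [[rr fr]|[]/eqP->//].
have [i bi si] := room_side rr fr.
have [ia|ib] := abi _ bi; subst i; [left|right]; apply/eqP.
  exact: side_uniq si sa.
exact: side_uniq si sb.
Qed.

End Door.

(** The index set of such a room is the singleton of [i0], so the room has one point, which
    dominance makes the maximum of [rk i0]. This door plays the part of a boundary facet. *)
Lemma empty_door_one_room (i0 : I) : (0 < #|T|)%N ->
  #|[set r | room r & facet (finset.set0, [set i0]) r]| = 1.
Proof.
move=> /card_gt0P[x0 _].
have [x _ xmax] := @arg_maxnP _ x0 xpredT (rk i0) isT.
suff -> : [set r | room r & facet (finset.set0, [set i0]) r] =
    [set ([set x], [set i0])] by rewrite cards1.
apply/setP => -[s C]; rewrite !inE; apply/andP/eqP.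
  move=> [/andP[/dominantP/= dom /eqP/= cs] /andP[/= _ Ci]].
  have [i iC hi] := dom x.
  have {Ci}Ci : C = [set i0].
    by move: Ci; rewrite subset1 => /orP[/eqP//|/eqP C0]; rewrite C0 inE in iC.
  move: cs; rewrite Ci cards1 => /eqP/cards1P[z sz]; rewrite {}sz in hi *.
  congr ([set _], _); apply: (rk_inj (i := i0)); apply/eqP.
  rewrite Ci inE in iC; rewrite -(eqP iC) eqn_leq hi ?inE// andbT.
  by rewrite (eqP iC); exact: xmax.
case=> -> ->; split; last by rewrite /facet/= sub0set subxx.
rewrite /room/= !cards1 eqxx andbT; apply/dominantP => y.
by exists i0; rewrite ?inE// => z; rewrite inE => /eqP->; exact: xmax.
Qed.

(** * Parity count of typed doors *)

Section Colouring.
Variable i0 : I.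

(** The analogue of Sperner's facets carrying all colours but one. Dominance is left out, so that
    the count for a given room is a matter of finite sets only. *)
Definition typed_door d :=
  [&& i0 \in d.2, c @: d.1 == d.2 :\ i0 & #|d.2| == #|d.1|.+1].

Definition colourful r := c @: r.1 == r.2.

(* A colourful room has a single typed door: drop the point coloured [i0], or
   add [i0] to the indices. In any other room having a typed door, a colour is
   repeated or lies outside the indices, which yields exactly one more. *)
Lemma odd_typed_doors r : #|r.1| = #|r.2| ->
  odd #|[set d | typed_door d & facet d r]| = colourful r.
Proof.
case: r => s C /= cs; have [/eqP/= col|ncol] := boolP (colourful (s, C)).
  have cinj : {in s &, injective c} by apply/imset_injP; rewrite col cs.
  have [iC|iC] := boolP (i0 \in C).
    have /imsetP[x xs xi] : i0 \in c @: s by rewrite col.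
    have -> : [set d | typed_door d & facet d (s, C)] = [set (s :\ x, C)].
      apply/setP => d; rewrite !inE; apply/andP/eqP; last first.
        move=> ->; rewrite /facet/= subD1set subxx; split=> //.
        rewrite /typed_door/= iC -cs [#|s|](cardsD1 x) xs eqxx andbT.
        rewrite -col; apply/eqP/setP => j; rewrite inE inE; apply/imsetP/andP.
          case=> y; rewrite !inE => /andP[yx ys] ->; rewrite imset_f//.
          split=> //; rewrite xi; apply: contra yx => /eqP cyx.
          by apply/eqP; apply: cinj.
        case=> ji /imsetP[y ys jy]; exists y => //; rewrite !inE ys andbT.
        by apply: contra ji => /eqP yx; rewrite jy yx xi.
      case=> /and3P[id /eqP cd /eqP cardd] fd.
      have [[i i_d [es eC]]|[y yd [es eC]]] := facetP (r := (s, C)) cardd cs fd.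
        have /eqP := col; rewrite es cd eC => /eqP h.
        have ii : i = i0.
          apply/eqP/negPn/negP => ii.
          have : i \in d.2 :\ i0 by rewrite !inE ii.
          by rewrite h !inE eqxx.
        by move: iC; rewrite eC ii !inE eqxx.
      have yx : y = x.
        have /imsetP[z] : i0 \in c @: s by rewrite col.
        rewrite es in_setU1 => /orP[/eqP -> iy|zd iz].
          by apply: cinj => //; rewrite ?es ?setU11// -xi.
        have : i0 \in c @: d.1 by rewrite iz imset_f.
        by rewrite cd !inE eqxx.
      rewrite es eC -yx setU1K//; exact: surjective_pairing.
    by rewrite cards1.
  have -> : [set d | typed_door d & facet d (s, C)] = [set (s, i0 |: C)].
    apply/setP => d; rewrite !inE; apply/andP/eqP; last first.
      move=> ->; rewrite /facet/= subsetU1 subxx; split=> //.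
      rewrite /typed_door/= setU11 setU1K// col eqxx cardsU1 iC cs add1n.
      by rewrite eqxx.
    case=> /and3P[id /eqP cd /eqP cardd] fd.
    have [[i i_d [es eC]]|[y yd [es eC]]] := facetP (r := (s, C)) cardd cs fd.
      have ii : i = i0.
        apply/eqP/negPn/negP => ii; move: iC; rewrite eC !inE eq_sym ii.
        by rewrite id.
      rewrite es eC ii setD1K//; exact: surjective_pairing.
    by move: iC; rewrite eC id.
  by rewrite cards1.
have [E0|[d0 d0E]] := set_0Vmem [set d | typed_door d & facet d (s, C)].
  by rewrite E0 cards0.
(* Either kind of typed door reduces to this situation: without [x], the points carry each colour of
   [C :\ i0] exactly once. *)
have {d0 d0E} [x [xs iC csx cx]] : exists x,
    [/\ x \in s, i0 \in C, c @: (s :\ x) = C :\ i0 & c x != i0].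
  move: d0E; rewrite inE => /andP[/and3P[id /eqP cd /eqP cardd] fd].
  have [[i i_d [es eC]]|[y yd [es eC]]] := facetP (r := (s, C)) cardd cs fd.
    have ii : i != i0.
      by apply: contra ncol => /eqP ii; rewrite /colourful/= es eC ii cd.
    have cinj : {in s &, injective c}.
      apply/imset_injP; rewrite es cd.
      by have := cardsD1 i0 d0.2; rewrite id cardd => -[->].
    have : i \in c @: s by rewrite es cd !inE ii.
    case/imsetP => x xs ix; exists x; rewrite -ix; split=> //.
      by rewrite eC !inE eq_sym ii.
    apply/setP => j; apply/imsetP/idP.
      case=> y; rewrite !inE => /andP[yx ys] ->.
      have : c y \in c @: s by rewrite imset_f.
      rewrite es cd eC !inE => /andP[-> ->]; rewrite andbT/= ix.
      by apply: contra yx => /eqP cyx; apply/eqP/cinj.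
    rewrite eC !inE => /and3P[ji0 ji jd].
    have : j \in c @: s by rewrite es cd !inE ji0.
    case/imsetP => y ys jy; exists y => //; rewrite !inE ys andbT.
    by apply: contra ji => /eqP yx; rewrite jy yx ix.
  exists y; rewrite es eC setU11 setU1K//; split=> //.
  apply: contra ncol => /eqP cy; rewrite /colourful/= es eC imsetU1 cd cy.
  by rewrite setD1K.
have csx' : #|s :\ x| = #|C :\ i0|.
  have := cardsD1 x s; have := cardsD1 i0 C; rewrite xs iC -cs => -> /eqP.
  by rewrite eqn_add2l => /eqP ->.
have cinj : {in s :\ x &, injective c} by apply/imset_injP; rewrite csx csx'.
have cardC : #|C| = #|s :\ x|.+1 by rewrite -cs (cardsD1 x) xs.
pose d1 := (s :\ x, C).
have d1E : typed_door d1 && facet d1 (s, C).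
  by rewrite /typed_door/facet/= iC csx eqxx cardC eqxx subD1set subxx.
suff [d2 [d2E d12 all2]] : exists d2, [/\ typed_door d2 && facet d2 (s, C),
    d1 != d2 & forall d, typed_door d && facet d (s, C) -> d = d1 \/ d = d2].
  have -> : [set d | typed_door d & facet d (s, C)] = [set d1; d2].
    apply/setP => d; rewrite !inE.
    by apply/idP/orP => [/all2[]->|[]/eqP->//]; [left|right].
  by rewrite cards2 d12.
(* If the colour of [x] is in [C], another point [x'] carries it, and removing [x'] instead of [x]
   gives the second door. *)
have [cxC|cxC] := boolP (c x \in C).
  have : c x \in c @: (s :\ x) by rewrite csx !inE cx.
  case/imsetP => x' x'sx cxx'; move: (x'sx); rewrite !inE => /andP[x'x x's].
  have csx2 : c @: (s :\ x') = C :\ i0.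
    rewrite -csx; apply/setP => j; apply/imsetP/imsetP => -[y].
      rewrite !inE => /andP[yx' ys] ->.
      have [->|yx] := eqVneq y x; first by exists x'.
      by exists y; rewrite // !inE yx.
    rewrite !inE => /andP[yx ys] ->.
    have [->|yx'] := eqVneq y x'; last by exists y; rewrite // !inE yx'.
    by exists x; rewrite // !inE xs eq_sym x'x.
  exists (s :\ x', C); split.
  - rewrite /typed_door/facet/= iC csx2 eqxx subD1set subxx !andbT/=.
    by rewrite -cs (cardsD1 x') x's.
  - apply/eqP => -[] h; have : x \in s :\ x by rewrite h !inE eq_sym x'x.
    by rewrite !inE eqxx.
  move=> d /andP[/and3P[id /eqP cd /eqP cardd] fd].
  have [[i i_d [es eC]]|[y yd [es eC]]] := facetP (r := (s, C)) cardd cs fd.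
    have /setP/(_ i) : c @: s = C :\ i0.
      rewrite -csx -[in LHS](setD1K xs) imsetU1; apply/setP => j.
      rewrite in_setU1; case: eqP => //= ->; by rewrite csx !inE cx.
    rewrite es cd eC !inE i_d eqxx/= andbF andbT => /negbFE/eqP ii.
    by move: iC; rewrite eC ii !inE eqxx.
  have ed : d = (s :\ y, C).
    by rewrite es eC setU1K//; exact: surjective_pairing.
  rewrite ed; have [->|yx] := eqVneq y x; [by left|right].
  suff -> : y = x' by [].
  apply/eqP/negPn/negP => yx'.
  have ys : y \in s by rewrite es setU11.
  have /setP/(_ (c y)) : c @: d.1 = C :\ i0 by rewrite cd eC.
  rewrite -csx [RHS]imset_f ?inE ?yx// => /imsetP[z zd cyz].
  have zs : z \in s by rewrite es setU1r.
  have zy : z != y by apply: contra yd => /eqP <-.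
  have [zx|zx] := eqVneq z x.
    have : y = x' by apply: cinj; rewrite ?inE ?yx ?x'x// cyz zx.
    by move/eqP; rewrite (negbTE yx').
  have : y = z by apply: cinj; rewrite ?inE ?yx ?zx.
  by move/eqP; rewrite eq_sym (negbTE zy).
(* Here the colour of [x] is a new index, and adding it to [C] gives the second door. *)
exists (s, c x |: C); split.
- rewrite /typed_door/facet/= setU1r// subsetU1 subxx cardsU1 cxC cs add1n eqxx.
  rewrite !andbT; apply/eqP; rewrite -[in LHS](setD1K xs) imsetU1 csx.
  rewrite setDUl; congr (_ :|: _); apply/esym/setDidPl.
  by rewrite disjoints1 inE.
- by apply/eqP => -[h _]; have := xs; rewrite -h !inE eqxx.
move=> d /andP[/and3P[id /eqP cd /eqP cardd] fd].
have [[i i_d [es eC]]|[y yd [es eC]]] := facetP (r := (s, C)) cardd cs fd.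
  right; suff ii : i = c x.
    rewrite es eC -ii setD1K//; exact: surjective_pairing.
  have : c x \in c @: s by rewrite imset_f.
  rewrite es cd !inE => /andP[_ cxd]; apply/eqP; move: cxC.
  by rewrite eC !inE cxd andbT negbK eq_sym.
left; rewrite /d1; suff <- : y = x.
  rewrite es eC setU1K//; exact: surjective_pairing.
apply/eqP/negPn/negP => yx.
have : c x \in c @: d.1.
  by rewrite imset_f//; move: xs; rewrite es in_setU1 eq_sym (negbTE yx).
by rewrite cd -eC !inE (negbTE cxC) andbF.
Qed.

(** Double counting, modulo 2, of the pairs of a room and one of its dominant typed doors: the count
    by rooms has the parity of the number of colourful rooms. *)
Lemma colourful_room : (0 < #|T|)%N -> exists2 r, room r & colourful r.
Proof.
move=> T0; suff : odd #|[set r | room r & colourful r]|.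
  case: (set_0Vmem [set r | room r & colourful r]) => [->|[r]].
    by rewrite cards0.
  by rewrite inE => /andP[? ?] _; exists r.
pose doors r := #|[set d | [&& dominant d, typed_door d & facet d r]]|.
have odd_doors r : room r -> odd (doors r) = colourful r.
  move=> /andP[domr /eqP cr]; rewrite -(odd_typed_doors cr).
  congr (odd #|pred_of_set _|); apply/setP => d; rewrite !inE.
  by case: (boolP (facet d r)) => [/dominant_facet/(_ domr)->|]; rewrite ?andbF.
have -> : odd #|[set r | room r & colourful r]| =
    odd (\sum_(r | room r) doors r).
  rewrite -sum1_card (eq_bigl (fun r => room r && colourful r)); last first.
    by move=> r; rewrite inE.
  rewrite big_mkcondr/= !(big_morph odd oddD (erefl _)).
  apply: eq_bigr => r rr; rewrite odd_doors//; by case: colourful.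
have -> : \sum_(r | room r) doors r =
    \sum_(d | dominant d && typed_door d) #|[set r | room r & facet d r]|.
  under eq_bigr do rewrite /doors -sum1dep_card.
  rewrite (exchange_big_dep (fun d => dominant d && typed_door d))/=.
    apply: eq_bigr => d /andP[domd td]; rewrite -sum1dep_card.
    by apply: eq_bigl => r; rewrite domd td.
  by move=> r d _ /and3P[-> ->].
(* The door without points lies in one room and the other dominant typed doors in two each, so the
   count by doors is odd. *)
have t0 :
    dominant (finset.set0, [set i0]) && typed_door (finset.set0, [set i0]).
  rewrite /typed_door/= imset0 setDv cards0 cards1 !eqxx set11 !andbT.
  by apply/dominantP => y; exists i0 => [|x]; rewrite ?set11 ?inE.
rewrite (bigD1 (finset.set0, [set i0]))/=; last exact: t0.
rewrite empty_door_one_room// oddD /=.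
rewrite (eq_bigr (fun=> 2)) ?sum_nat_const ?oddM ?andbF// => -[t D].
move=> /andP[/andP[dom /and3P[/= iD cD /eqP cardD]] ne].
have [t0E|[x xt]] := set_0Vmem t; last exact: door_two_rooms xt dom cardD.
move: ne cardD; rewrite t0E cards0 => ne /eqP/cards1P[i Di].
by move: iD ne; rewrite Di inE => /eqP->; rewrite eqxx.
Qed.

End Colouring.

End Scarf.

(** * Scarf's lemma on the grid points of a simplex *)

Section Grid.
Import ssrnat fintype mathcomp.boot.finset bigop.

(** For a colourful room [(s, C)], let [lo] be the coordinate minima of [s] on [C] and 0 elsewhere.
    Dominance makes the sum of [lo] larger than [N - n], so the other coordinates leave each one
    less than [n] above its [lo]. *)
Lemma grid_room (n N : nat) (c : {ffun 'I_n -> 'I_N.+1} -> 'I_n) :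
  (0 < n)%N ->
  exists (s : {set {ffun 'I_n -> 'I_N.+1}}) (lo : 'I_n -> nat),
    [/\ exists x, x \in s,
        forall x, x \in s -> (\sum_i x i)%N = N,
        forall x i, x \in s -> (lo i <= x i <= lo i + n)%N &
        forall i, lo i = 0%N \/ exists2 x, x \in s & c x = i].
Proof.
move=> n0; pose T := {x : {ffun 'I_n -> 'I_N.+1} | (\sum_i x i)%N == N}.
have sumT (x : T) : (\sum_i val x i)%N = N by apply/eqP; exact: (valP x).
have mkT (y : 'I_n -> nat) : (\sum_i y i)%N = N ->
    exists x : T, forall i, nat_of_ord (val x i) = y i.
  move=> ysum; pose x : {ffun 'I_n -> 'I_N.+1} := [ffun i => inord (y i)].
  have xE i : nat_of_ord (x i) = y i.
    by rewrite ffunE inordK// ltnS -ysum (bigD1 i)//= leq_addr.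
  have xT : (\sum_i x i)%N == N.
    by apply/eqP; rewrite -[RHS]ysum; apply: eq_bigr => i _; rewrite xE.
  by exists (exist _ x xT) => i /=.
have T0 : (0 < #|{: T}|)%N.
  have /mkT[x _] : (\sum_(i < n) (if i == Ordinal n0 then N else 0) = N)%N.
    by rewrite -big_mkcond/= big_pred1_eq.
  by apply/card_gt0P; exists x.
(* Comparison of the [i]-th coordinates, with ties broken by enumeration. *)
pose rk (i : 'I_n) (x : T) := (val x i * #|{: T}| + enum_rank x)%N.
have rk_inj i : injective (rk i).
  move=> x y /(congr1 (modn^~ #|{: T}|)); rewrite !modnMDl !modn_small//.
  by move/val_inj/enum_rank_inj.
have rk_le i x y : (rk i x <= rk i y)%N -> (val x i <= val y i)%N.
  case: (leqP (val x i) (val y i)) => // xy; rewrite /rk.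
  have := ltn_ord (enum_rank y).
  have := leq_mul2r #|{: T}| (val y i).+1 (val x i); rewrite xy orbT mulSn.
  move=> /= le1 lt2 le3.
  have := leq_ltn_trans (leq_trans (leq_addr _ _) le3) _.
  by move/(_ _ (leq_trans _ le1)); rewrite addnC ltn_add2r lt2 ltnn => /(_ isT).
have [[s C] /andP[/dominantP/= dom /eqP/= cs] /eqP/= col] :=
  @colourful_room T 'I_n rk (fun x => c (val x)) rk_inj (Ordinal n0) T0.
have {T0} [x0 x0s] : exists x, x \in s.
  have /card_gt0P[y _] := T0; have [i iC _] := dom y.
  by apply/card_gt0P; rewrite cs; apply/card_gt0P; exists i.
pose mn (i : 'I_n) := [arg min_(x < x0 in s) nat_of_ord (val x i)].
have mn_in i : mn i \in s by rewrite /mn; case: arg_minnP.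
have mn_le i x : x \in s -> (val (mn i) i <= val x i)%N.
  by rewrite /mn; case: arg_minnP => // y _ h /h.
pose lo i := if i \in C then nat_of_ord (val (mn i) i) else 0%N.
have lo_le i x : x \in s -> (lo i <= val x i)%N.
  by rewrite /lo; case: ifP => // _; exact: mn_le.
(* Otherwise some grid point exceeds [lo] at every index of [C], the surplus of its total being put
   on [i0]; this contradicts dominance. *)
have lo_sum : (N < \sum_i lo i + n)%N.
  rewrite ltnNge; apply/negP => le.
  have [i0 i0C _] := dom x0.
  pose y0 i := if i \in C then (lo i).+1 else 0%N.
  have y0N : (\sum_i y0 i <= N)%N.
    apply: leq_trans le; rewrite -[X in (_ + X)%N]card_ord -sum1_card.
    rewrite -big_split/=; apply: leq_sum => i _; rewrite /y0.
    by case: ifP; rewrite ?addn1.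
  pose y i := (y0 i + if i == i0 then N - \sum_i y0 i else 0)%N.
  have [x xy] : exists x : T, forall i, nat_of_ord (val x i) = y i.
    apply: mkT; rewrite big_split/= -[X in (_ + X)%N]big_mkcond/= big_pred1_eq.
    by rewrite subnKC.
  have [i iC /(_ _ (mn_in i))/rk_le] := dom x.
  by rewrite xy /y /y0 iC /lo iC addSn ltnNge leq_addr.
exists [set val x | x in s], lo; split.
- by exists (val x0); apply: imset_f.
- by move=> _ /imsetP[x _ ->]; exact: sumT.
- move=> _ i /imsetP[x xs ->]; rewrite lo_le//=.
  have le : (\sum_(j | j != i) lo j <= \sum_(j | j != i) val x j)%N.
    by apply: leq_sum => j _; exact: lo_le.
  have xN : (val x i + \sum_(j | j != i) val x j)%N = N.
    by rewrite -[RHS](sumT x) [RHS](bigD1 i).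
  rewrite -(leq_add2r (\sum_(j | j != i) val x j)) xN.
  apply: ltnW; apply: leq_trans lo_sum _.
  by rewrite (bigD1 i)//= addnAC leq_add2l.
move=> i; have [iC|iC] := boolP (i \in C); last first.
  by left; rewrite /lo (negbTE iC).
right; move: iC; rewrite -col => /imsetP[x xs ->].
by exists (val x) => //; apply: imset_f.
Qed.

End Grid.

Local Open Scope classical_set_scope.
Local Open Scope ring_scope.

(** * Covers of the simplex *)

Definition simplex (R : realType) n : set 'rV[R]_n :=
  [set t | (forall i, 0 <= t 0 i) /\ \sum_i t 0 i = 1].

Arguments simplex {R n}.

Section Simplex.
Context {R : realType} {n : nat}.
Implicit Types (t : 'rV[R]_n) (A U : 'I_n -> set 'rV[R]_n).

Lemma simplex_le1 t i : simplex t -> t 0 i <= 1.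
Proof.
by move=> [t0 <-]; rewrite (bigD1 i)//= lerDl sumr_ge0.
Qed.

Lemma sum_continuous (T : topologicalType) (h : 'I_n -> T -> R) :
  (forall i, continuous (h i)) -> continuous (fun x => \sum_i h i x).
Proof.
by move=> hc x; apply: cvg_big => [|i _]; [exact: add_continuous|exact: hc].
Qed.

Lemma simplex_compact : compact (@simplex R n).
Proof.
apply: (@subclosed_compact _ _
  [set t : 'rV[R]_n | forall i, `[0, 1]%classic (t ord0 i)]).
- have -> : @simplex R n = (\bigcap_i [set t : 'rV[R]_n | 0 <= t 0 i]) `&`
      [set t : 'rV[R]_n | \sum_i t 0 i = 1].
    by apply/seteqP; split => t [t0 t1]; split => // i; [move=> _|]; exact: t0.
  apply: closedI.
    apply: closed_bigI => i _.
    apply: (@preimage_closed _ _ (fun t : 'rV[R]_n => t 0 i) [set x | 0 <= x]).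
      by move=> t _; exact: coord_continuous.
    exact: closed_ge.
  apply: (@preimage_closed _ _ (fun t : 'rV[R]_n => \sum_i t 0 i)
    [set x | x = 1]).
    by move=> t _; apply: sum_continuous => i; exact: coord_continuous.
  exact: closed_eq.
- apply: (@rV_compact R n (fun=> `[0, 1]%classic)) => i.
  exact: segment_compact.
- by move=> t st i; rewrite /= in_itv/= simplex_le1// andbT; case: st.
Qed.

(** Each grid point is coloured by a set of the cover that contains it; [t] is any point of the
    cluster given by [grid_room], which is small at the scale of the mesh. *)
Lemma approximate_simplex_cover A (N : nat) : (0 < n)%N ->
  (forall t, simplex t -> exists i, A i t) ->
  exists2 t, simplex t & forall i,
    t 0 i <= n%:R / N.+1%:R \/
    exists2 p, A i p & forall j, `|p 0 j - t 0 j| <= n%:R / N.+1%:R.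
Proof.
move=> n0 cover.
(* The total is [N.+1], so that dividing by it is meaningful for every [N]. *)
pose point (x : {ffun 'I_n -> 'I_N.+2}) : 'rV[R]_n :=
  \row_i ((x i)%:R / N.+1%:R).
have point_simplex (x : {ffun 'I_n -> 'I_N.+2}) :
    (\sum_i x i)%N = N.+1 -> simplex (point x).
  move=> xN; split => [i|]; first by rewrite mxE divr_ge0.
  under eq_bigr do rewrite mxE.
  by rewrite -mulr_suml -natr_sum xN divff// pnatr_eq0.
have /choice[c cA] : forall x : {ffun 'I_n -> 'I_N.+2}, exists i,
    (\sum_i x i)%N = N.+1 -> A i (point x).
  move=> x; have [xN|xN] := eqVneq (\sum_i x i)%N N.+1.
    by have [i Ai] := cover _ (point_simplex _ xN); exists i.
  by exists (Ordinal n0) => /eqP; rewrite (negbTE xN).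
have [s [lo [[x xs] sumN bnd lo_c]]] := grid_room c n0.
exists (point x) => [|i]; first exact/point_simplex/sumN.
have [lo0|[z zs zi]] := lo_c i.
  left; rewrite mxE ler_pM2r ?invr_gt0// ler_nat.
  by have /andP[_] := bnd _ i xs; rewrite lo0.
right; exists (point z); first by rewrite -zi; exact/cA/sumN.
move=> j; rewrite !mxE -mulrBl normrM [X in _ * X]ger0_norm ?invr_ge0//.
rewrite ler_pM2r ?invr_gt0// ler_norml.
have /andP[] := bnd _ j xs; have /andP[] := bnd _ j zs.
rewrite -!(ler_nat R) !natrD; lra.
Qed.

(* Unlike in the KKM lemma, the closed cover is arbitrary: the conclusion is
   vacuous at the vanishing coordinates. *)
Lemma simplex_closed_cover A :
  (forall i, closed (A i)) -> (forall t, simplex t -> exists i, A i t) ->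
  (0 < n)%N ->
  exists2 t, simplex t & forall i, t 0 i = 0 \/ A i t.
Proof.
move=> Acl cover n0.
have /choice[u uP] : forall N, exists t, simplex t /\ forall i,
    t 0 i <= n%:R / N.+1%:R \/
    exists2 p, A i p & forall j, `|p 0 j - t 0 j| <= n%:R / N.+1%:R.
  by move=> N; have [t st ht] := approximate_simplex_cover N n0 cover; exists t.
have Fu : \forall N \near \oo, simplex (u N) by apply: nearW => N; case: (uP N).
have [t [st clt]] : exists t : 'rV[R]_n, simplex t /\ cluster (u @ \oo) t.
  by have [t ?] := @simplex_compact (u @ \oo) _ Fu; exists t.
exists t => // i; have [t0|t0] := eqVneq (t 0 i) 0; [by left|right].
apply/not_notP => Ait.
have ti : 0 < t 0 i by rewrite lt_neqAle eq_sym t0/=; case: st.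
have : nbhs t (~` A i).
  by apply: open_nbhs_nbhs; split=> //; exact: closed_openC.
move=> /nbhs_ballP tA.
have [e e0 eA] : exists2 e : R, 0 < e & ball t e `<=` ~` A i by [].
(* [d] will bound both the error of the approximation and the distance from [u N] to [t]. *)
have [d [d0 de dt]] : exists d : R, [/\ 0 < d, d + d <= e & d + d <= t 0 i].
  exists (Num.min e (t 0 i) / 2); rewrite -splitr.
  by rewrite divr_gt0 ?lt_min ?e0// !ge_min !lexx orbT.
have small : \forall N \near \oo, n%:R / N.+1%:R < d.
  have /cvgrPdist_lt/(_ (d / n%:R)) : (@harmonic R) @ \oo --> 0.
    exact: cvg_harmonic.
  rewrite divr_gt0 ?ltr0n// => /(_ isT); apply: filterS => N.
  rewrite sub0r normrN ger0_norm ?invr_ge0// ltr_pdivlMr ?ltr0n//.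
  by rewrite mulrC.
have : (u @ \oo) (u @` [set N | n%:R / N.+1%:R < d]).
  by apply: filterS small => N hN; exists N.
move=> /clt/(_ (nbhsx_ballx t d d0))[_ [[N /= hN <-] [_ tu]]].
have {}tu j : `|t 0 j - u N 0 j| < d by exact: tu.
have [_ /(_ i)[ui|[p Ap pu]]] := uP N.
  have := tu i; rewrite ltr_norml => /andP[_ tui].
  move: (le_lt_trans ui hN) => uid; lra.
apply: (eA p) => //; split=> // k j; rewrite ord1.
have tp : `|t 0 j - p 0 j| < e.
  rewrite -[t 0 j - _](subrKA (u N 0 j)) (le_lt_trans (ler_normD _ _))//.
  by apply: lt_le_trans de; rewrite ltrD// distrC (le_lt_trans (pu j)).
exact: tp.
Qed.

Section OpenCover.
Variable U : 'I_n -> set 'rV[R]_n.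
Hypothesis U_open : forall i t, simplex t -> U i t ->
  exists2 e : R, 0 < e & forall s, simplex s -> `|t - s| < e -> U i s.

(* Distance to the complement of [U i], truncated at 1 so that no case
   distinction is needed when that complement is empty. *)
Let g i t := inf ([set 1] `|` [set `|t - s| | s in simplex `\` U i]).

Let g_has i t : has_inf ([set 1] `|` [set `|t - s| | s in simplex `\` U i]).
Proof.
split; first by exists 1; left.
by exists 0 => _ [->//|[s _ <-]].
Qed.

Let g_ge i t x : x <= 1 -> (forall s, simplex s -> ~ U i s -> x <= `|t - s|) ->
  x <= g i t.
Proof.
move=> x1 h; apply: lb_le_inf; first by exists 1; left.
by move=> _ [->//|[s [ss Us] <-]]; exact: h.
Qed.

Let g_le i t s : simplex s -> ~ U i s -> g i t <= `|t - s|.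
Proof.
by move=> ss Us; apply: ge_inf; [case: (g_has i t)|right; exists s].
Qed.

Let g_le1 i t : g i t <= 1.
Proof. by apply: ge_inf; [by case: (g_has i t)|left]. Qed.

Let g_lip i t s : g i t <= g i s + `|t - s|.
Proof.
rewrite -lerBlDr; apply: g_ge => [|p sp Up].
  by rewrite lerBlDr (le_trans (g_le1 _ _))// lerDl.
by rewrite lerBlDr addrC (le_trans (g_le _ sp Up))// ler_distD.
Qed.

Let g_continuous i : continuous (g i).
Proof.
move=> t; apply/(@cvgrPdist_lt _ _ _ _ (nbhs_filter t)) => e e0.
have : \forall s \near t, `|t - s| < e.
  by apply/nbhs_ballP; exists e => //= s; rewrite mx_norm_ball.
apply: filterS => s; apply: le_lt_trans; rewrite ler_norml.
have := g_lip i t s; have := g_lip i s t; rewrite distrC.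
by move=> ? ?; apply/andP; split; lra.
Qed.

Let g_ge0 i t : 0 <= g i t.
Proof. by apply: g_ge. Qed.

Let g_gt0 i t : simplex t -> U i t -> 0 < g i t.
Proof.
move=> st /(U_open st)[e e0 eU]; apply: (@lt_le_trans _ _ (Num.min e 1)).
  by rewrite lt_min e0 ltr01.
apply: g_ge => [|s ss Us]; first by rewrite ge_min lexx orbT.
rewrite ge_min leNgt; apply/orP; left; apply/negP => ts.
exact/Us/eU.
Qed.

(** The inequalities t_i G(t) <= g_i(t) cannot all fail, as both sides have the same sum over i.
    They define a closed cover, and where t_i > 0 such an inequality forces g_i(t) > 0, because the
    open cover makes G(t) positive. *)
Lemma simplex_open_cover : (0 < n)%N ->
  (forall t, simplex t -> exists i, U i t) ->
  exists2 t, simplex t & forall i, 0 < t 0 i -> U i t.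
Proof.
move=> n0 cover; pose G t := \sum_i g i t.
have Gc : continuous G by apply: sum_continuous.
pose A i := [set t : 'rV[R]_n | 0 <= g i t - t 0 i * G t].
have Acl i : closed (A i).
  apply: (@preimage_closed _ _ (fun t : 'rV[R]_n => g i t - t 0 i * G t)
    [set x | 0 <= x]); last exact: closed_ge.
  move=> t _; have Ft : Filter (nbhs t) by exact: nbhs_filter.
  apply: (cvgB (@g_continuous i t)).
  exact: (cvgM (@coord_continuous R _ _ 0 i t) (Gc t)).
have Acover t : simplex t -> exists i, A i t.
  move=> st; apply/not_existsP => h.
  have : G t < \sum_i t 0 i * G t.
    apply: ltr_sum => [|i _]; first by apply/hasP; exists (Ordinal n0).
    by have /negP := h i; rewrite -ltNge subr_lt0.
  by rewrite -mulr_suml (proj2 st) mul1r ltxx.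
have [t st tA] := simplex_closed_cover Acl Acover n0.
exists t => // i ti; apply/not_notP => Ut.
have [|] := tA i; first by move=> t0; rewrite t0 ltxx in ti.
have gi0 : g i t = 0.
  apply/eqP; rewrite eq_le g_ge0 andbT (le_trans (g_le t st Ut))//.
  by rewrite subrr normr0.
rewrite /A/= gi0 sub0r oppr_ge0 leNgt mulr_gt0//.
have [j Uj] := cover t st.
by rewrite /G (bigD1 j)//= ltr_pwDl ?g_gt0// sumr_ge0.
Qed.

End OpenCover.

End Simplex.

(** * Hahn-Banach theorem and weak compactness *)

Section HahnBanach.
Context {R : realType} {V : lmodType R}.
Implicit Types (p q : V -> R) (A : set V) (v w u : V).

Definition sublinear q :=
  (forall v w, q (v + w) <= q v + q w) /\
  (forall (t : R) v, 0 <= t -> q (t *: v) = t * q v).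

Lemma sublinear0 q : sublinear q -> q 0 = 0.
Proof. by case=> _ /(_ 0 0 (lexx _)); rewrite scaler0 mul0r. Qed.

Lemma sublinear_geN q v : sublinear q -> - q (- v) <= q v.
Proof.
move=> qs; have := proj1 qs v (- v); rewrite subrr sublinear0//; lra.
Qed.

Section Shift.
Variables (q : V -> R) (A : set V) (d : R).
Hypotheses (qs : sublinear q) (A0 : A !=set0)
  (cvxA : forall (s : R) a b, 0 <= s -> s <= 1 -> A a -> A b ->
    A (s *: a + (1 - s) *: b))
  (dA : forall a, A a -> d <= q a).

(** A sublinear q' <= q with q'(- a) <= - d on [A] satisfies q'(v) <= q(v + t a) - t d for t >= 0.
    The infimum of these bounds is therefore the largest candidate. *)
Let vals v := [set x | exists t a,
  [/\ 0 <= t, A a & x = q (v + t *: a) - t * d]].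

Let vals_has v : has_inf (vals v).
Proof.
case: A0 => a0 Aa0; case: qs => qD qZ; split.
  by exists (q (v + 0 *: a0) - 0 * d), 0, a0.
exists (- q (- v)) => _ [t [a [t0 Aa ->]]].
have := qD (v + t *: a) (- v); rewrite addrAC subrr add0r qZ//.
have := ler_wpM2l t0 (dA Aa); lra.
Qed.

Let shift v := inf (vals v).

Let shift_le v t a : 0 <= t -> A a -> shift v <= q (v + t *: a) - t * d.
Proof.
by move=> t0 Aa; apply: ge_inf; [case: (vals_has v)|exists t, a].
Qed.

Let shift_ge v x :
  (forall t a, 0 <= t -> A a -> x <= q (v + t *: a) - t * d) -> x <= shift v.
Proof.
move=> h; apply: lb_le_inf; first by case: (vals_has v).
by move=> _ [t [a [t0 Aa ->]]]; exact: h.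
Qed.

Let shift_le_q v : shift v <= q v.
Proof.
case: A0 => a Aa; have := shift_le v (lexx 0) Aa.
by rewrite scale0r addr0 mul0r subr0.
Qed.

Let shiftD v w : shift (v + w) <= shift v + shift w.
Proof.
case: qs => qD qZ.
rewrite -lerBlDr; apply: shift_ge => t a t0 Aa.
rewrite lerBlDr [_ + shift w]addrC -lerBlDr; apply: shift_ge => s b s0 Ab.
rewrite lerBlDr.
have [ts0|ts0] := eqVneq (t + s) 0.
  have -> : t = 0 by lra.
  have -> : s = 0 by lra.
  rewrite !scale0r !mul0r !addr0 !subr0 addrC.
  exact: le_trans (shift_le_q _) (qD _ _).
have ts : 0 < t + s by rewrite lt_neqAle eq_sym ts0 addr_ge0.
(* Convexity of [A] merges the two shifts: t a + s b = (t + s) c. *)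
pose c := (t / (t + s)) *: a + (1 - t / (t + s)) *: b.
have Ac : A c.
  apply: cvxA => //; first by rewrite divr_ge0// ltW.
  by rewrite ler_pdivrMr// mul1r lerDl.
have := shift_le (v + w) (ltW ts) Ac.
have -> : v + w + (t + s) *: c = (v + t *: a) + (w + s *: b).
  have e : (t + s) * (t / (t + s)) = t by rewrite mulrC divfK.
  rewrite /c scalerDr !scalerA mulrBr e mulr1 [t + s - t]addrAC subrr add0r.
  by rewrite addrACA.
have := qD (v + t *: a) (w + s *: b); lra.
Qed.

Let shiftZ_le (t : R) v : 0 < t -> shift (t *: v) <= t * shift v.
Proof.
move=> t0; rewrite -ler_pdivrMl//; apply: shift_ge => s a s0 Aa.
rewrite ler_pdivrMl//.
have -> : t * (q (v + s *: a) - s * d) =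
    q (t *: v + (t * s) *: a) - (t * s) * d.
  by rewrite -scalerA -scalerDr (proj2 qs _ _ (ltW t0)) mulrBr mulrA.
by apply: shift_le => //; rewrite mulr_ge0// ltW.
Qed.

(* For a singleton [A] this makes minimal sublinear functions odd; for [q] the
   norm it separates a point from a convex set. *)
Lemma sublinear_shift : exists q', [/\ sublinear q', forall v, q' v <= q v &
  forall a, A a -> q' (- a) <= - d].
Proof.
exists shift; split => //; last first.
  move=> a Aa; have := shift_le (- a) ler01 Aa.
  by rewrite scale1r addNr sublinear0// mul1r sub0r.
split=> // t v; rewrite le_eqVlt => /orP[/eqP<-|t0].
  rewrite scale0r mul0r; apply/eqP; rewrite eq_le -{1}(sublinear0 qs).
  rewrite shift_le_q /=; apply: shift_ge => s a s0 Aa.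
  by rewrite add0r (proj2 qs)// -mulrBr mulr_ge0// subr_ge0 dA.
apply/eqP; rewrite eq_le shiftZ_le//= -ler_pdivlMl//.
by rewrite -[in leLHS](scalerK (lt0r_neq0 t0) v) shiftZ_le// invr_gt0.
Qed.

End Shift.

(** Zorn's lemma for the reversed pointwise order: a nonempty chain is bounded by its pointwise
    infimum, finite because every member is at least - p(- v). *)
Lemma sublinear_minorant p : sublinear p ->
  exists2 q, sublinear q /\ (forall v, q v <= p v) &
    forall q', sublinear q' -> (forall v, q' v <= q v) -> q' = q.
Proof.
move=> ps; pose T := {q : V -> R | sublinear q /\ forall v, q v <= p v}.
pose le (s t : T) := `[< forall v, sval t v <= sval s v >].
have T_lower (s : T) v : - p (- v) <= sval s v.
  case: s => s [ss sp] /=; apply: le_trans (sublinear_geN v ss).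
  by rewrite lerN2.
have [| | | |[q [qs qp]] qmax] := @Zorn T le.
- by move=> s; apply/asboolP.
- move=> s t u /asboolP st /asboolP tu; apply/asboolP => v.
  exact: le_trans (tu v) (st v).
- move=> [s sP] [t tP] /asboolP/= st /asboolP/= ts.
  have e : s = t by apply/funext => v; apply/eqP; rewrite eq_le st ts.
  by apply: eq_exist.
- move=> A totA; have [[s0 As0]|A0] := pselect (A !=set0); last first.
    exists (exist _ p (conj ps (fun=> lexx _))) => s As.
    by case: A0; exists s.
  pose vals v := [set sval s v | s in A].
  have vals_has v : has_inf (vals v).
    split; first by exists (sval s0 v), s0.
    by exists (- p (- v)) => _ [s _ <-]; exact: T_lower.
  pose m v := inf (vals v).
  have m_le s v : A s -> m v <= sval s v.
    by move=> As; apply: ge_inf; [case: (vals_has v)|exists s].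
  have m_ge v x : (forall s, A s -> x <= sval s v) -> x <= m v.
    move=> h; apply: lb_le_inf; first by case: (vals_has v).
    by move=> _ [s As <-]; exact: h.
  have ms : sublinear m.
    split=> [v w|t v t0].
      rewrite -lerBlDr; apply: (m_ge v) => s As.
      rewrite lerBlDr [_ + m w]addrC -lerBlDr; apply: (m_ge w) => s' As'.
      rewrite lerBlDr.
      (* The smaller of two members of the chain bounds both terms, and its own subadditivity gives
         that of the infimum. *)
      have key s1 : A s1 -> (forall z, sval s1 z <= sval s z) ->
          (forall z, sval s1 z <= sval s' z) ->
          m (v + w) <= sval s' w + sval s v.
        move=> As1 h h'; apply: le_trans (m_le _ _ As1) _.
        rewrite [leRHS]addrC (le_trans (proj1 (proj1 (svalP s1)) v w))//.
        by rewrite lerD.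
      case: (totA s s' As As') => /asboolP h; first exact: (key s').
      exact: (key s).
    have Zle (c : R) z : 0 < c -> m (c *: z) <= c * m z.
      move=> c0; rewrite -ler_pdivrMl//; apply: (m_ge z) => s As.
      rewrite ler_pdivrMl//; have <- := proj2 (proj1 (svalP s)) _ z (ltW c0).
      exact: m_le.
    move: t0; rewrite le_eqVlt => /orP[/eqP<-|t0].
      rewrite scale0r mul0r; apply/eqP; rewrite eq_le.
      rewrite -{1}(sublinear0 (proj1 (svalP s0))) m_le//=.
      by apply: (m_ge 0) => s _; rewrite (sublinear0 (proj1 (svalP s))).
    apply/eqP; rewrite eq_le Zle//= -ler_pdivlMl//.
    by rewrite -[in leLHS](scalerK (lt0r_neq0 t0) v) Zle// invr_gt0.
  have mp v : m v <= p v.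
    exact: le_trans (m_le _ _ As0) (proj2 (svalP s0) v).
  by exists (exist _ m (conj ms mp)) => s As; apply/asboolP => v; exact: m_le.
exists q => // q' q's q'q.
have q'p v : q' v <= p v by exact: le_trans (q'q v) (qp v).
have := qmax (exist _ q' (conj q's q'p)) => /(_ (asboolT q'q)).
by move/(congr1 sval).
Qed.

(** A minimal sublinear function is linear: shifting it along a single point [u] cannot lower it,
    which gives q(- u) = - q(u), and an odd sublinear function is additive. *)
Theorem hahn_banach p : sublinear p ->
  exists2 phi : V -> R^o, linear phi & forall v, phi v <= p v.
Proof.
move=> /sublinear_minorant[q [qs qp] qmin].
have qN u : q (- u) = - q u.
  apply/eqP; rewrite eq_le; apply/andP; split; last first.
    by have := sublinear_geN u qs; lra.
  have [||||q' [q's q'q q'u]] := @sublinear_shift q [set u] (q u).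
  - exact: qs.
  - by exists u.
  - move=> s a b s0 s1 /= -> ->.
    by rewrite -scalerDl addrC subrK scale1r.
  - by move=> a ->.
  by rewrite -(qmin q' q's q'q); rewrite {2}(qmin q' q's q'q); exact: q'u.
have qD v w : q (v + w) = q v + q w.
  apply/eqP; rewrite eq_le (proj1 qs)/=.
  have := proj1 qs (- v) (- w); rewrite -opprD !qN; lra.
exists q => // a u v; rewrite qD; congr (_ + _).
have [a0|/ltW a0] := leP 0 a; first exact: (proj2 qs).
by rewrite -[a]opprK scaleNr qN (proj2 qs) ?oppr_ge0// scaleNr.
Qed.

End HahnBanach.

(** * Separation, weak closures and weak compactness *)

Section Weak.
Context {R : realType}.
Implicit Types (X : normedModType R).

Lemma convex_setE (V : lmodType R) (K : set V) (s : R) a b :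
  convex_set K -> 0 <= s -> s <= 1 -> K a -> K b -> K (s *: a + (1 - s) *: b).
Proof.
move=> cK s0 s1 Ka Kb.
have s01 : Itv.spec (Itv.num_sem (R := R)) (Itv.Real `[0%Z, 1%Z]) s.
  by rewrite /=/Itv.num_sem/= num_real in_itv/= s0 s1.
have := cK a b (Itv.mk s01); rewrite !inE => /(_ Ka Kb).
by [].
Qed.

Lemma bounded_form_continuous X (phi : X -> R^o) (M : R) : linear phi ->
  (forall x, `|phi x| <= M * `|x|) -> continuous phi.
Proof.
move=> lphi bnd x; apply/cvgrPdist_lt => e e0.
have M0 : 0 < `|M| + 1 by rewrite ltr_pwDr.
have : \forall y \near x, `|x - y| < e / (`|M| + 1).
  apply/nbhs_ballP; exists (e / (`|M| + 1)); first by rewrite /= divr_gt0.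
  by move=> y; rewrite -ball_normE.
apply: filterS => y; rewrite ltr_pdivlMr// => xy.
have -> : phi x - phi y = phi (x - y).
  by have := lphi (-1) y x; rewrite !scaleN1r [- y + x]addrC => ->;
    rewrite addrC.
apply: le_lt_trans (bnd _) _; apply: le_lt_trans xy.
by rewrite mulrC ler_wpM2l// (le_trans (ler_norm _))// lerDl.
Qed.

Lemma exists_dual X (phi : X -> R^o) (M : R) : linear phi ->
  (forall x, `|phi x| <= M * `|x|) ->
  exists psi : dual X, forall x, psi x = phi x.
Proof.
move=> lphi bnd.
have phiP : phi \in @continuous_linear_form R X.
  by apply/asboolP; split=> //; exact: bounded_form_continuous bnd.
by exists (exist _ phi phiP : dual X).
Qed.

Lemma dual_bound X (phi : dual X) (x : X) : `|phi x| <= dual_norm phi * `|x|.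
Proof.
have [->|x0] := eqVneq x 0; first by rewrite dual0 !normr0 mulr0.
have nx : 0 < `|x| by rewrite normr_gt0.
rewrite -ler_pdivrMr// mulrC -[X in X * _]ger0_norm ?invr_ge0//.
have := @ler_dual_norm _ _ phi (`|x|^-1 *: x).
rewrite dualZ normrM normrZ normfV normr_id mulVf ?gt_eqF//; exact.
Qed.

(** The norm is shifted along K - x0, with [d] the radius of a ball around [x0] that misses [K]. A
    linear form below the result is bounded by the norm and separates. *)
Lemma convex_separation X (K : set X) (x0 : X) :
  closed K -> convex_set K -> K !=set0 -> ~ K x0 ->
  exists (phi : dual X) (d : R), 0 < d /\ forall k, K k -> d <= phi k - phi x0.
Proof.
move=> clK cK [k0 Kk0] Kx0.
have : nbhs x0 (~` K) by apply: open_nbhs_nbhs; split=> //; exact: closed_openC.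
move=> /nbhs_ballP[d /= d0 dK].
pose A := [set k - x0 | k in K].
have norms : sublinear (fun x : X => `|x|).
  split=> [v w|t v t0]; first exact: ler_normD.
  by rewrite normrZ ger0_norm.
have [|||q [qs qn qA]] := @sublinear_shift R X (fun x => `|x|) A d norms.
- by exists (k0 - x0), k0.
- move=> s _ _ s0 s1 [a Ka <-] [b Kb <-].
  exists (s *: a + (1 - s) *: b); first exact: convex_setE.
  by rewrite !scalerBr addrACA -opprD -scalerDl [s + _]addrC subrK scale1r.
- move=> _ [k Kk <-]; rewrite leNgt; apply/negP => kd.
  by apply: (dK k) => //; rewrite -ball_normE/= distrC.
have [phi lphi phiq] := hahn_banach qs.
have phi_le x : phi x <= `|x| by exact: le_trans (phiq x) (qn x).
have phi0 : phi 0 = 0.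
  by have := lphi (-1) 0 0; rewrite scaler0 addr0 scaleN1r addNr.
have phiN x : phi (- x) = - phi x.
  by have := lphi (-1) x 0; rewrite phi0 !addr0 !scaleN1r.
have [|psi psiE] := @exists_dual X phi 1 lphi.
  move=> x; rewrite mul1r ler_norml phi_le andbT lerNl -phiN -normrN.
  exact: phi_le.
exists psi, d; split=> // k Kk; rewrite !psiE.
have : phi (- (k - x0)) <= - d by apply: le_trans (phiq _) (qA _ _); exists k.
rewrite opprB; have := lphi (-1) k x0; rewrite scaleN1r [- k + _]addrC => ->.
by rewrite scaleN1r; lra.
Qed.

Lemma weak_cvg X (F : set_system X) (x : X) : Filter F ->
  (forall phi : dual X, phi u @[u --> F] --> phi x) ->
  F --> (x : weak_space X).
Proof.
move=> FF h; apply/cvg_sup => phi A; rewrite nbhsE => -[B [[C oC CB] Bx] BA].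
apply: filterS BA _; rewrite -CB; apply: (h phi).
by apply: open_nbhs_nbhs; split=> //; rewrite -CB in Bx.
Qed.

Lemma dual_weak_continuous X (phi : dual X) :
  continuous (phi : weak_space X -> R^o).
Proof.
move=> x A Ax.
have /cvg_sup/(_ phi) : nbhs (x : weak_space X) --> (x : weak_space X) by [].
apply; exact: (@initial_continuous _ _ (phi : X -> R^o) x A Ax).
Qed.

Lemma weak_nbhs_norm X (x : X) (U : set X) :
  nbhs (x : weak_space X) U -> nbhs x U.
Proof. by apply: weak_cvg => phi; exact: dual_continuous. Qed.

(** Mazur's theorem: a form separating [x] from [K] defines a weak neighbourhood of [x] that misses
    [K]. *)
Lemma convex_weak_closure X (K : set X) : closed K -> convex_set K ->
  closure (K : set (weak_space X)) `<=` K.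
Proof.
move=> clK cK x clx; apply/not_notP => Kx.
have [[k0 Kk0]|K0] := pselect (K !=set0); last first.
  by have [y [Ky _]] := clx setT filterT; case: K0; exists y.
have [phi [d [d0 dK]]] := convex_separation clK cK (ex_intro _ k0 Kk0) Kx.
have : nbhs (x : weak_space X) [set u | `|phi x - phi u| < d].
  by move/cvgrPdist_lt: (@dual_weak_continuous X phi x); exact.
move=> /clx[k [Kk /=]]; rewrite distrC => kd.
by have := le_lt_trans (le_trans (dK k Kk) (ler_norm _)) kd; rewrite ltxx.
Qed.

Lemma ultra_bounded_cvg (T : Type) (F : set_system T) (g : T -> R) (M : R) :
  UltraFilter F -> F [set u | `|g u| <= M] ->
  exists2 l : R, `|l| <= M & g u @[u --> F] --> l.
Proof.
move=> FU FM; have := @segment_compact R (- M) M => /(_ (g @ F) _).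
case=> [|l [lM cll]].
  have : F (g @^-1` `[- M, M]).
    by apply: filterS FM => u; rewrite /= ler_norml in_itv.
  exact.
exists l; first by move: lM; rewrite /= in_itv/= ler_norml.
move=> A lA; have [//|FnA] := in_ultra_setVsetC (g @^-1` A) FU.
by have [y [nAy Ay]] := cll (~` A) A FnA lA.
Qed.

(** Along an ultrafilter on [K] every continuous form converges; reflexivity turns the limits into a
    point, the weak limit, which stays in [K] by Mazur's theorem. *)
Lemma reflexive_weak_compact X (K : set X) (rho : R) : reflexive_space X ->
  closed K -> convex_set K -> (forall x, K x -> `|x| <= rho) ->
  compact (K : set (weak_space X)).
Proof.
move=> reflX clK cK Krho; rewrite compact_ultra => F FU FK.
have rho0 : 0 <= rho.
  by have [x Kx] := filter_ex FK; exact: le_trans (normr_ge0 x) (Krho x Kx).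
(* The pointwise limit along [F] is an element of the bidual. *)
have lim_ex (phi : dual X) : exists l : R^o,
    `|l| <= rho * dual_norm phi /\ phi u @[u --> F] --> l.
  have [|l ll Fl] := @ultra_bounded_cvg _ F phi (rho * dual_norm phi) FU.
    apply: filterS FK => x /Krho xrho /=; apply: le_trans (dual_bound _ _) _.
    by rewrite mulrC ler_wpM2r// dual_norm_ge0.
  by exists l.
have [L LP] := choice lim_ex.
have linL : linear L.
  move=> a phi psi; have lim1 := proj2 (LP (a *: phi + psi)).
  have lim2 : (a *: phi + psi : dual X) u @[u --> F] --> a *: L phi + L psi.
    exact: cvgD (cvgZ (cvg_cst a) (proj2 (LP phi))) (proj2 (LP psi)).
  exact: norm_cvg_unique lim1 lim2.
have [L' L'E] := @exists_dual _ L rho linL (fun phi => proj1 (LP phi)).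
have [x xE] := reflX L'.
have Fx : F --> (x : weak_space X).
  by apply: weak_cvg => phi; rewrite -xE L'E; exact: (proj2 (LP _)).
exists x; split=> //; apply: convex_weak_closure => // A /Fx FA.
exact: filter_ex (filterI FK FA).
Qed.

End Weak.

(** * Self segment-dense sets *)

Section Density.
Context {R : realType} {X : normedModType R}.
Implicit Types (D K : set X).

Lemma closure_normP D (z : X) :
  closure D z <-> forall e : R, 0 < e -> exists2 u, D u & `|z - u| < e.
Proof.
split=> [clz e e0|h B /nbhs_ballP[e /= e0 eB]].
  have [u [Du zu]] := clz _ (nbhsx_ballx z e e0); exists u => //.
  by move: zu; rewrite -ball_normE.
have [u Du zu] := h e e0; exists u; split=> //.
by apply: eB; rewrite -ball_normE.
Qed.

(** A form [phi] with phi(y - x) > 0 controls the parameter of a point of the segment, so weak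
    approximation within the segment is norm approximation. *)
Lemma segment_norm_closure D K (x y : X) (t : R) :
  self_segment_dense (X := weak_space X) D K -> D x -> D y ->
  0 <= t -> t <= 1 -> closure D (x + t *: (y - x)).
Proof.
move=> [_ _ dense] Dx Dy t0 t1; apply/closure_normP => e e0.
have [xy|xy] := eqVneq x y.
  by exists x; rewrite // xy subrr scaler0 addr0 subrr normr0.
have [||||phi [d [d0 phid]]] := @convex_separation R X [set y] x.
- apply: accessible_closed_set1; apply: hausdorff_accessible.
  exact: norm_hausdorff.
- by move=> a b l; rewrite !inE => -> ->; rewrite convmm.
- by exists y.
- by move/eqP: xy.
have {}phid := phid y erefl.
have nyx : 0 < `|y - x| by rewrite normr_gt0 subr_eq0 eq_sym.
have phiB (a b : X) : phi (a - b) = phi a - phi b.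
  have := dual_linear phi (-1) b a; rewrite !scaleN1r [- b + a]addrC => ->.
  exact: addrC.
have {}phid : 0 < phi (y - x) by rewrite phiB (lt_le_trans d0).
have seg : closure (segment (X := weak_space X) x y `&` D : set (weak_space X))
    (x + t *: (y - x)).
  by apply: dense => //; exists t => //=; rewrite t0 t1.
(* This radius for [phi] amounts to |t - s| |y - x| < e for the parameters. *)
have e'0 : 0 < e / `|y - x| * phi (y - x) by rewrite mulr_gt0// divr_gt0.
have : nbhs (x + t *: (y - x) : weak_space X)
    [set u | `|phi (x + t *: (y - x)) - phi u| < e / `|y - x| * phi (y - x)].
  move/cvgrPdist_lt : (@dual_weak_continuous R X phi (x + t *: (y - x))).
  by apply.
move=> /seg[_ [[[s /= _ <-] Du] /=]].
have tsE : x + t *: (y - x) - (x + s *: (y - x)) = (t - s) *: (y - x).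
  by rewrite opprD addrACA subrr add0r scalerBl.
rewrite -phiB tsE dualZ normrM.
rewrite [X in _ * X]gtr0_norm// ltr_pM2r// ltr_pdivlMr// => ts.
by exists (x + s *: (y - x)); rewrite // tsE normrZ.
Qed.

Lemma self_segment_dense_norm D K :
  self_segment_dense (X := weak_space X) D K -> K `<=` closure D.
Proof.
move=> dense; have [_ KD _] := dense.
(* Half of the error goes to moving the end points into [D], half to moving their combination into
   [D]. *)
have cD : convex_set (closure D).
  move=> a b l; rewrite !inE => /closure_normP Da /closure_normP Db.
  apply/closure_normP => e e0.
  have e20 : 0 < e / 2 by rewrite divr_gt0.
  have [a' Da' aa'] := Da _ e20; have [b' Db' bb'] := Db _ e20.
  have l0 : 0 <= l%:num by [].
  have l1 : l%:num <= 1 by [].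
  have /closure_normP/(_ _ e20)[u Du uw] :=
    segment_norm_closure dense Db' Da' l0 l1.
  exists u => //.
  apply: le_lt_trans (ler_distD (b' + l%:num *: (a' - b')) _ _) _.
  rewrite [ltRHS]splitr; apply: ler_ltD uw.
  have -> : conv l a b - (b' + l%:num *: (a' - b')) =
      l%:num *: (a - a') + (1 - l%:num) *: (b - b').
    rewrite -[conv l a b]/(l%:num *: a + (1 - l%:num) *: b).
    have -> : b' + l%:num *: (a' - b') = l%:num *: a' + (1 - l%:num) *: b'.
      by rewrite scalerBr scalerBl scale1r addrCA.
    by rewrite !scalerBr addrACA opprD.
  apply: le_trans (ler_normD _ _) _; rewrite !normrZ !ger0_norm ?subr_ge0//.
  have l1' : 0 <= 1 - l%:num by rewrite subr_ge0.
  have := ler_wpM2l l0 (ltW aa').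
  have := ler_wpM2l l1' (ltW bb'); lra.
(* The norm closure of [D], being convex, is weakly closed, and its subset [D] is weakly dense in
   [K]. *)
move=> x Kx; apply: (convex_weak_closure (@closed_closure _ D) cD).
move=> B /(KD _ Kx)[u [Du Bu]]; exists u; split=> //; exact: subset_closure.
Qed.

End Density.

(** * Convex combinations, cones and semicontinuity *)

Lemma convex_set_sum (R : realType) (V : lmodType R) (A : set V) n
    (t : 'I_n -> R) (x : 'I_n -> V) : convex_set A ->
  (forall i, 0 <= t i) -> \sum_i t i = 1 -> (forall i, A (x i)) ->
  A (\sum_i t i *: x i).
Proof.
move=> cA; elim: n t x => [|n ih] t x t0 t1 Ax.
  by move: t1; rewrite big_ord0 => /esym/eqP; rewrite oner_eq0.
rewrite big_ord_recr/=; move: t1; rewrite big_ord_recr/=.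
set s := \sum_(i < n) _ => st.
have s0 : 0 <= s by exact: sumr_ge0.
have tE : t ord_max = 1 - s by rewrite -st addrAC subrr add0r.
have s1 : s <= 1 by have := t0 ord_max; rewrite tE subr_ge0.
(* If the first weights all vanish they cannot be renormalized, and the sum is its last point. *)
have [s00|sn0] := eqVneq s 0.
  rewrite big1 ?add0r ?tE ?s00 ?subr0 ?scale1r// => i _.
  have /eqP := s00; rewrite psumr_eq0// => /allP/(_ i (mem_index_enum i))/eqP->.
  by rewrite scale0r.
pose w (i : 'I_n) := widen_ord (leqnSn n) i.
have -> : \sum_(i < n) t (w i) *: x (w i) =
    s *: \sum_(i < n) (t (w i) / s) *: x (w i).
  rewrite scaler_sumr; apply: eq_bigr => i _.
  by rewrite scalerA mulrC divfK.
rewrite tE; apply: convex_setE => //; apply: ih => [i||i] //.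
  by rewrite divr_ge0.
by rewrite -mulr_suml divff.
Qed.

Section ConvexCone.
Context {R : realType} {Z : tvsType R} (C : set Z).
Hypothesis convexC : convex_cone C.

Lemma convex_coneD a b : C a -> C b -> C (a + b).
Proof.
by move=> Ca Cb; case: convexC => _ CE; rewrite -CE; exists a => //; exists b.
Qed.

Lemma interior_coneD a b : interior C a -> C b -> interior C (a + b).
Proof.
move=> Ca Cb; have h : nbhs (a + b) ((fun z => z - b) @^-1` C).
  have : (fun z : Z => z - b) @ (a + b) --> (a + b) - b.
    have := @add_continuous Z (a + b, - b).
    apply: (cvg_comp2 (f := id) (g := cst (- b))); first exact: cvg_id.
    exact: cvg_cst.
  by apply; rewrite addrK.
apply: filterS h => z /= Czb; rewrite -[z](subrK b); exact: convex_coneD.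
Qed.

Lemma nbhs_scale (t : R) a (A : set Z) : nbhs (t *: a) A ->
  exists2 U : set R, nbhs t U & exists2 W, nbhs a W &
    forall s z, U s -> W z -> A (s *: z).
Proof.
move=> /(@scale_continuous R Z (t, a))[[U W] [/= Ut Wa] UW].
by exists U => //; exists W => // s z Us Wz; apply: (UW (s, z)).
Qed.

Lemma interior_coneZ (t : R) a : 0 < t -> interior C a -> interior C (t *: a).
Proof.
move=> t0 Ca; have tC : nbhs (t^-1 *: (t *: a)) C by rewrite scalerK// gt_eqF.
have [U Ut [W Wa UW]] := nbhs_scale tC.
apply: filterS Wa => z Wz.
have -> : z = t *: (t^-1 *: z) by rewrite scalerA divff ?scale1r// gt_eqF.
by apply: (proj1 convexC); [exact: ltW|apply: UW => //; exact: nbhs_singleton].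
Qed.

Lemma interior_cone_sum n (t : 'I_n -> R) (z : 'I_n -> Z) (i0 : 'I_n) :
  (forall i, 0 <= t i) -> 0 < t i0 ->
  (forall i, 0 < t i -> interior C (z i)) -> interior C (\sum_i t i *: z i).
Proof.
move=> t0 ti0 zC; have C0 : C 0.
  rewrite -(scale0r (z i0)); apply: (proj1 convexC) => //.
  by apply: interior_subset; exact: zC.
rewrite (bigD1 i0)//=; apply: interior_coneD.
  by apply: interior_coneZ => //; exact: zC.
apply: big_ind => [//||i _]; first exact: convex_coneD.
have := t0 i; rewrite le_eqVlt => /orP[/eqP<-|ti]; first by rewrite scale0r.
by apply: interior_subset; apply: interior_coneZ => //; exact: zC.
Qed.

(** If 0 were interior, [C] would contain small positive multiples of both [z] and [- z], against
    pointedness. *)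
Lemma interior_cone0 : pointed_cone C -> (exists z : Z, z <> 0) ->
  ~ interior C 0.
Proof.
move=> pC [z z0] C0.
have near0 (w : Z) : \forall t \near (0 : R), C (t *: w).
  have wC : nbhs (0 *: w) C by rewrite scale0r.
  have [U U0 [W Ww UW]] := nbhs_scale wC.
  by apply: filterS U0 => s Us; apply: UW => //; exact: nbhs_singleton.
have : nbhs (0 : R) ([set t | C (t *: z)] `&` [set t | C (t *: - z)]).
  exact: filterI (near0 z) (near0 (- z)).
move=> /nbhs_ballP[e /= e0 eC].
have e20 : 0 < e / 2 by rewrite divr_gt0.
have [Cz CNz] : C ((e / 2) *: z) /\ C ((e / 2) *: - z).
  apply: eC; rewrite -ball_normE/= sub0r normrN gtr0_norm// gtr_pMr//.
  by rewrite invf_lt1 ?ltr1n.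
have : (C `&` [set - c | c in C]) ((e / 2) *: z).
  by split=> //; exists ((e / 2) *: - z); rewrite // scalerN opprK.
rewrite pC => /eqP; rewrite scaler_eq0 (gt_eqF e20)/= => /eqP.
exact: z0.
Qed.

(** Stated as a preimage to avoid the witnesses of an image. *)
Definition neg_interior := [set z : Z | interior C (- z)].

Lemma neg_interiorE z : [set - c | c in interior C] z <-> neg_interior z.
Proof.
split=> [[c Cc <-]|Cz]; first by rewrite /neg_interior/= opprK.
by exists (- z); rewrite ?opprK.
Qed.

Lemma neg_interior_le a b : cone_le C a b -> neg_interior b -> neg_interior a.
Proof.
move=> Cab Cb; rewrite /neg_interior/=.
have -> : - a = - b + (b - a) by rewrite addrA addNr add0r.
exact: interior_coneD.
Qed.

(** The set - int C is open and stable under subtraction of [C], so it can serve as the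
    neighbourhood in upper semicontinuity. *)
Lemma neg_interior_usc (T : topologicalType) (K : set T) (g : T -> Z) (x : T) :
  upper_semicontinuous_at C K g x -> neg_interior (g x) ->
  exists2 U, nbhs x U & forall u, U u -> K u -> neg_interior (g u).
Proof.
move=> usc Ngx; have : nbhs (g x) neg_interior.
  apply: (@opp_continuous Z (g x)); apply: open_nbhs_nbhs; split=> //.
  exact: open_interior.
move=> /usc[U xU UV]; exists U => // u Uu Ku.
have [v Nv [c Cc <-]] := UV u (conj Uu Ku).
by rewrite /neg_interior/= opprB addrC; exact: interior_coneD.
Qed.

End ConvexCone.

Lemma cone_convex_on2 (R : realType) (X Z : lmodType R) (C : set Z) (K : set X)
    (g : X -> Z) (t : R) a b : cone_convex_on C K g -> K a -> K b ->
  0 <= t -> t <= 1 -> K (t *: a + (1 - t) *: b) ->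
  cone_le C (g (t *: a + (1 - t) *: b)) (t *: g a + (1 - t) *: g b).
Proof.
move=> cg Ka Kb t0 t1 Kab.
pose x (i : 'I_2) := if i == ord0 then a else b.
pose l (i : 'I_2) := if i == ord0 then t else 1 - t.
have := cg 2%N x l; rewrite !big_ord_recl !big_ord0 !addr0 /x /l/=; apply => //.
- by move=> i; case: ifP.
- by move=> i; case: ifP => // _; rewrite subr_ge0.
- by rewrite addrC subrK.
Qed.

(** * Equilibrium problems *)

Section KyFan.
Context {R : realType} {X : normedModType R} {Z : tvsType R}.
Variables (C : set Z) (K : set X) (f : X -> X -> Z).
Hypotheses (convexC : convex_cone C) (pointedC : pointed_cone C)
  (nontrivialZ : exists z : Z, z <> 0)
  (f_convex : forall x, K x -> cone_convex_on C K (f x))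
  (f_diag : forall x, K x -> f x x = 0).

Let NI := neg_interior C.

(** Otherwise the sets of weights [t] at which [y i] strictly improves on [pt t] cover the simplex.
    At the [t] of [simplex_open_cover], convexity bounds f(x, x) = 0 by a combination lying in - int
    C, so that 0 is interior to [C]. *)
Lemma finite_equilibrium (B : set X) n (y : 'I_n -> X) : (0 < n)%N ->
  convex_set B -> B `<=` K -> (forall i, B (y i)) ->
  (forall i x, K x -> upper_semicontinuous_at (T := weak_space X) C K
    (fun u => f u (y i)) x) ->
  exists2 x, B x & forall i, ~ NI (f x (y i)).
Proof.
move=> n0 cB BK By usc; apply/not_exists2P => noeq.
pose pt (t : 'rV[R]_n) := \sum_i t 0 i *: y i.
have ptB t : simplex t -> B (pt t) by move=> [t0 t1]; exact: convex_set_sum.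
pose U i := [set t : 'rV[R]_n | NI (f (pt t) (y i))].
(* The sum of norms is a Lipschitz constant of [pt]; adding 1 makes [M] positive and the estimate
   strict. *)
pose M := \sum_i `|y i| + 1.
have M0 : 0 < M by rewrite ltr_wpDl// sumr_ge0.
have U_open i t : simplex t -> U i t ->
    exists2 e : R, 0 < e & forall s, simplex s -> `|t - s| < e -> U i s.
  move=> st Uit; have Kt : K (pt t) by exact/BK/ptB.
  have [W tW WNI] := neg_interior_usc convexC (usc i _ Kt) Uit.
  have /nbhs_ballP[e /= e0 eW] := weak_nbhs_norm tW.
  exists (e / M) => [|s ss ts]; first by rewrite divr_gt0.
  apply: WNI; last exact/BK/ptB.
  apply: eW; rewrite -ball_normE /= /pt -sumrB.
  apply: le_lt_trans (ler_norm_sum _ _ _) _.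
  apply: (@le_lt_trans _ _ (\sum_i e / M * `|y i|)).
    apply: ler_sum => j _; rewrite -scalerBl normrZ ler_wpM2r// ltW//.
    have : ball t (e / M) s by rewrite mx_norm_ball.
    by case=> _ /(_ 0 j).
  rewrite -mulr_sumr -[ltRHS](divfK (lt0r_neq0 M0)).
  by rewrite ltr_pM2l ?divr_gt0// /M ltrDl.
have [|t st tU] := simplex_open_cover U_open n0.
  move=> t /ptB Bt; apply/not_existsP => h.
  by case: (noeq (pt t)) => // all_no; apply: all_no => i; exact: h.
have Kt : K (pt t) by exact/BK/ptB.
have [i0 ti0] : exists i, 0 < t 0 i.
  apply/not_existsP => h; have := proj2 st; rewrite big1 => [/esym/eqP|i _].
    by rewrite oner_eq0.
  by apply/eqP; rewrite eq_le (proj1 st) andbT leNgt; exact/negP/h.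
have := f_convex Kt (fun i => BK _ (By i)) (proj1 st) (proj2 st) Kt.
rewrite -/(pt t) f_diag// => le0.
have N0 : NI 0.
  apply: (neg_interior_le convexC le0).
  rewrite /neg_interior/= -sumrN.
  under eq_bigr do rewrite -scalerN.
  apply: (interior_cone_sum convexC (proj1 st) ti0) => i; exact: tU.
by apply: (interior_cone0 pointedC nontrivialZ); rewrite -oppr0.
Qed.

(** The solution sets for finite lists of test points generate a proper filter, and a weak cluster
    point of it solves the problem for all of [Y]. *)
Lemma compact_equilibrium (B Y : set X) :
  compact (B : set (weak_space X)) -> B !=set0 ->
  convex_set B -> B `<=` K -> Y `<=` B ->
  (forall y, Y y -> forall x, K x ->
    upper_semicontinuous_at (T := weak_space X) C K (fun u => f u y) x) ->
  exists2 x, B x & forall y, Y y -> ~ NI (f x y).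
Proof.
move=> cptB B0 cB BK YB usc.
pose good (s : seq X) := B `&` [set x | forall y, y \in s -> ~ NI (f x y)].
have good0 s : {subset s <= Y} -> good s !=set0.
  (* The finite problem requires a test point, so the empty list is treated apart. *)
  case: s => [_|y0 s sY]; first by have [b Bb] := B0; exists b; split.
  have sYi (i : 'I_(size (y0 :: s))) : Y (nth y0 (y0 :: s) i).
    by apply/set_mem/sY/mem_nth.
  have [//|i||x Bx xs] := @finite_equilibrium B _
    (fun i : 'I_(size (y0 :: s)) => nth y0 (y0 :: s) i) _ cB BK.
  - exact/YB.
  - by move=> i x Kx; exact: usc.
  exists x; split=> // y; rewrite -index_mem => ys.
  by have := xs (Ordinal ys); rewrite /= nth_index// -index_mem.
pose F : set_system (weak_space X) :=
  [set A | exists2 s : seq X, {subset s <= Y} & good s `<=` A].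
have FF : ProperFilter F.
  apply: Build_ProperFilter_ex.
    by move=> A [s /good0[x gx] sA]; exists x; exact: sA.
  split.
  - by exists [::].
  - move=> A A' [s sY sA] [s' s'Y s'A']; exists (s ++ s').
      by move=> y; rewrite mem_cat => /orP[/sY|/s'Y].
    move=> x [Bx xs]; split; [apply: sA|apply: s'A']; split=> // y ys;
      by apply: xs; rewrite mem_cat ys ?orbT.
  - by move=> A A' AA' [s sY sA]; exists s => // x /sA/AA'.
have [|x [Bx clx]] := cptB F FF; first by exists [::] => // x [].
exists x => // y Yy Nxy.
(* A strict improvement at [x] would persist on [K] in a weak neighbourhood of [x], which must meet
   [good [:: y]]. *)
have [W xW WN] := neg_interior_usc convexC (usc y Yy x (BK x Bx)) Nxy.
have Fy : F (good [:: y]).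
  by exists [:: y] => // z; rewrite inE => /eqP->; exact: mem_set.
have [u [[Bu uy] Wu]] := clx _ _ Fy xW.
by apply: (uy y); [rewrite inE|exact: WN (BK u Bu)].
Qed.

(* A strict improvement anywhere in [K] can be pulled back along the segment
   towards [w] into the open ball, where none is available. *)
Lemma equilibrium_extension (rho : R) x w : convex_set K -> K x ->
  (forall y, K y -> `|y| < rho -> ~ NI (f x y)) ->
  K w -> `|w| < rho -> f x w = 0 ->
  forall y, K y -> ~ NI (f x y).
Proof.
move=> cK Kx noNI Kw wrho fw0 y Ky Ny.
pose d := rho - `|w|; have d0 : 0 < d by rewrite subr_gt0.
have den0 : 0 < d + `|y| + 1 by rewrite addr_gt0// ltr_pwDl.
have [t [t0 t1 ty]] : exists t : R, [/\ 0 < t, t <= 1 & t * `|y| < d].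
  (* With this weight, [y] contributes less than the slack [d] left by [w] in the ball. *)
  exists (d / (d + `|y| + 1)); split; first by rewrite divr_gt0.
    by rewrite ler_pdivrMr// mul1r -addrA lerDl addr_ge0.
  by rewrite mulrAC ltr_pdivrMr// ltr_pM2l// -addrA addrC -addrA ltrDl addr_gt0.
have Kz : K (t *: y + (1 - t) *: w) by apply: convex_setE => //; exact: ltW.
have le := cone_convex_on2 (f_convex Kx) Ky Kw (ltW t0) t1 Kz.
apply: (noNI _ Kz).
  apply: le_lt_trans (ler_normD _ _) _.
  rewrite !normrZ gtr0_norm// ger0_norm ?subr_ge0//.
  rewrite -[ltRHS](subrK `|w|) -/d ltr_leD//.
  by rewrite ler_piMl// lerBlDr lerDl ltW.
(* As f(x, w) = 0, convexity gives f(x, z) <= t f(x, y) at the pulled-back point z. *)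
apply: (neg_interior_le convexC le); rewrite fw0 scaler0 addr0.
by rewrite /neg_interior/= -scalerN; exact: interior_coneZ.
Qed.

End KyFan.

Theorem theorem3p5 (R : realType) (X : completeNormedModType R) (Z : tvsType R)
    (C : set Z) (K D : set X) (f : X -> X -> Z)
    (reflexiveX : reflexive_space X)
    (hausdorffZ : hausdorff_space Z)
    (nontrivialZ : exists z : Z, z <> 0)
    (convexC : convex_cone C) (pointedC : pointed_cone C)
    (intC : interior C !=set0)
    (K0 : K !=set0) (convexK : convex_set K) (closedK : closed K)
    (denseD : self_segment_dense (X := weak_space X) D K)
    (f_usc1 : forall y, D y -> forall x, K x ->
      upper_semicontinuous_at (T := weak_space X) C K
        (fun u => f u y) x)
    (f_usc2 : forall x, K x -> forall y, (K `\` D) y ->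
      upper_semicontinuous_at (T := weak_space X) C K
        (fun u => f x u) y)
    (f_convex : forall x, K x -> cone_convex_on C K (f x))
    (f_diag : forall x, K x -> f x x = 0)
    (f_coercive : exists2 r : R, 0 < r &
      forall x, K x -> r < `|x| ->
        exists y0, [/\ K y0, `|y0| < `|x| &
          ([set - c | c in interior C] `|` [set 0]) (f x y0)]) :
  exists2 x0, K x0 &
    forall y, K y -> ~ [set - c | c in interior C] (f x0 y).
Proof.
have [DK _ _] := denseD; have [k0 Kk0] := K0.
have [r r0 coercive] := f_coercive.
(* Larger than [r], so that coercivity applies on the sphere, and large enough for [B] to contain
   [k0]. *)
pose rho := Num.max r `|k0| + 1.
have r_rho : r < rho by rewrite ltr_pwDr// le_max lexx.
have k0_rho : `|k0| <= rho by rewrite ler_wpDr// le_max lexx orbT.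
pose B := K `&` [set x | `|x| <= rho].
have BK : B `<=` K by move=> x [].
have cB : convex_set B.
  move=> a b l; rewrite !inE => -[Ka arho] [Kb brho]; split.
    by have := convexK a b l; rewrite !inE; exact.
  have l0 : 0 <= l%:num by [].
  have l1 : 0 <= 1 - l%:num by rewrite subr_ge0.
  rewrite -[conv l a b]/(l%:num *: a + (1 - l%:num) *: b) /=.
  apply: le_trans (ler_normD _ _) _; rewrite !normrZ !ger0_norm//.
  have := ler_wpM2l l0 arho; have := ler_wpM2l l1 brho; lra.
have clB : closed B.
  apply: closedI => //.
  apply: (@preimage_closed _ _ (fun x : X => `|x|) [set t | t <= rho]).
    by move=> x _; exact: norm_continuous.
  exact: closed_le.
have cptB : compact (B : set (weak_space X)).
  by apply: (@reflexive_weak_compact _ _ B rho) => // x [].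
pose Y := D `&` [set y | `|y| < rho].
have [|||||x0 [Kx0 x0rho] x0Y] := @compact_equilibrium R X Z C K f convexC
  pointedC nontrivialZ f_convex f_diag B Y cptB.
- by exists k0.
- exact: cB.
- exact: BK.
- by move=> y [/DK Ky /ltW yrho].
- by move=> y [Dy _]; exact: f_usc1.
(* An improvement at a point off [D] would persist at nearby points of [D], still of norm below
   [rho]. *)
have x0_ball y : K y -> `|y| < rho -> ~ neg_interior C (f x0 y).
  move=> Ky yrho; have [Dy|Dy] := pselect (D y); first exact: x0Y.
  move=> Ny; have [U yU UN] := neg_interior_usc convexC
    (f_usc2 x0 Kx0 y (conj Ky Dy)) Ny.
  have yrho_nbhs : nbhs y [set u : X | `|u| < rho].
    apply/nbhs_ballP; exists (rho - `|y|); first by rewrite /= subr_gt0.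
    move=> u; rewrite -ball_normE/= ltrBrDr addrC; apply: le_lt_trans.
    by rewrite -{1}[u](subKr y) ler_normB.
  have [u [Du [Uu urho]]] := self_segment_dense_norm denseD Ky
    (filterI (weak_nbhs_norm yU) yrho_nbhs).
  by apply: (x0Y u); [|exact: UN (DK u Du)].
(* Inside the ball [x0] itself serves. On the sphere coercivity provides [w], and [x0_ball] rules
   out a value in - int C there, leaving 0. *)
have [w [Kw wrho fw0]] : exists w, [/\ K w, `|w| < rho & f x0 w = 0].
  move: x0rho; rewrite /= le_eqVlt => /orP[/eqP x0E|x0rho]; last first.
    by exists x0; rewrite f_diag.
  have [|w [Kw wx0 fw]] := coercive x0 Kx0; first by rewrite x0E.
  exists w; rewrite -x0E; split=> //.
  case: fw => // /neg_interiorE fw; case: (x0_ball w) => //.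
  by rewrite -x0E.
exists x0 => // y Ky /neg_interiorE.
exact: (equilibrium_extension convexC f_convex convexK Kx0 x0_ball Kw wrho fw0).
Qed.
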